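(* For each $T>0$, there exist positive constants $\delta,C_1,C_2$ such that $$-C_2|t-s|^{-1/2}\Delta t\le E[F(s)(F(t+\Delta t)-F(t))]\le -C_1|t+\Delta t-s|^{-1/2}\Delta t,$$ for all $0\le s<t\le T$ and $\Delta t>0$ such that $|t-s|<\delta$ and $\Delta t<\delta$.
   Context: Fix $\alpha\in(0,1)$. Let $B=\{B(t):t\ge 0\}$ be a one-dimensional Brownian motion with random initial position, i.e. $B(t)=B(0)+W(t)$ with $W$ a standard Brownian motion started at $0$ and independent of $B(0)$. Assume $B(0)$ has a density $f\in C^\infty(\mathbb{R})$ that is a Schwartz function, i.e. $\sup_{x\in\mathbb{R}}(1+|x|^n)|f^{(m)}(x)|<\infty$ for all nonnegative integers $n,m$. Assume that $f(x)\,dx$ has a unique $\alpha$-quantile $q(0)$ (i.e. a unique number with $\int_{-\infty}^{q(0)}f(x)\,dx=\alpha$) and that $f(q(0))>0$. Let $u(x,t)$ denote the density of $B(t)$ (so $u(x,0)=f(x)$), and for $t>0$ let $q(t)$ be the (unique) $\alpha$-quantile of the law of $B(t)$. $F=\{F(t):t\ge 0\}$ is a centered Gaussian process (with continuous paths) with covariance function $$\rho(s,t)=E[F(s)F(t)]=\frac{P(B(s)\le q(s),\,B(t)\le q(t))-\alpha^2}{u(q(s),s)\,u(q(t),t)}.$$ Here $\Delta t$ denotes a single positive real number. *)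

(* Defs.v *)
From HB Require Import structures.
From mathcomp Require Import all_boot all_order all_algebra.
From mathcomp Require Import all_classical all_reals all_analysis.

Set Implicit Arguments.
Unset Strict Implicit.
Unset Printing Implicit Defensive.

Import Order.TTheory GRing.Theory Num.Theory.
Import numFieldNormedType.Exports.

Local Open Scope classical_set_scope.
Local Open Scope ring_scope.

Definition smooth (R : realType) (f : R -> R) : Prop :=
  forall (m : nat) (x : R), derivable (f^`(m))%classic x 1.

Definition schwartz (R : realType) (f : R -> R) : Prop :=
  smooth f /\
  forall n m : nat, has_ubound (range (fun x : R => (1 + `|x| ^+ n) * `|(f^`(m))%classic x|)).

Definition is_density (R : realType) (d : measure_display)
    (Omega : measurableType d) (P : probability Omega R)
    (X : {RV P >-> R}) (f : R -> R) : Prop :=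
  [/\ forall x : R, 0 <= f x,
      measurable_fun setT f
    & forall A : set R, measurable A ->
        P (X @^-1` A) = (\int[lebesgue_measure]_(x in A) (f x)%:E)%E].

(* Adequate for continuous laws, the only ones to which it is applied. *)
Definition is_quantile (R : realType) (d : measure_display)
    (Omega : measurableType d) (P : probability Omega R)
    (X : {RV P >-> R}) (a y : R) : Prop :=
  P [set w | X w <= y] = a%:E.

(* Taking some of the A i to be setT gives the product rule for subfamilies. *)
Definition mutually_independent (R : realType) (d : measure_display)
    (Omega : measurableType d) (P : probability Omega R)
    (I : finType) (X : I -> Omega -> R) : Prop :=
  forall A : I -> set R, (forall i : I, measurable (A i)) ->
    P (\bigcap_i (X i @^-1` A i)) = (\prod_(i : I) P (X i @^-1` A i))%E.

(* Processes are families indexed by R of which only the members with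
   nonnegative index matter. *)
Definition process_sigma (R : realType) (d : measure_display)
    (Omega : measurableType d) (P : probability Omega R)
    (X : R -> {RV P >-> R}) : set (set Omega) :=
  <<s [set E : set Omega | exists (t : R) (A : set R),
        [/\ 0 <= t, measurable A & E = X t @^-1` A]] >>.

Definition independent_of_process (R : realType) (d : measure_display)
    (Omega : measurableType d) (P : probability Omega R)
    (Y : {RV P >-> R}) (X : R -> {RV P >-> R}) : Prop :=
  forall (A : set R) (E : set Omega), measurable A -> process_sigma X E ->
    P ((Y @^-1` A) `&` E) = (P (Y @^-1` A) * P E)%E.

Definition continuous_paths (R : realType) (d : measure_display)
    (Omega : measurableType d) (P : probability Omega R)
    (X : R -> {RV P >-> R}) : Prop :=
  {ae P, forall w : Omega,
    {within [set t : R | 0 <= t], continuous (fun t : R => X t w)}}.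

Definition standard_brownian_motion (R : realType) (d : measure_display)
    (Omega : measurableType d) (P : probability Omega R)
    (W : R -> {RV P >-> R}) : Prop :=
  [/\ {ae P, forall w : Omega, W 0 w = 0},
      forall (n : nat) (t : nat -> R), 0 <= t 0%N ->
        (forall i : nat, t i <= t i.+1) ->
        mutually_independent P
          (fun (i : 'I_n) (w : Omega) => W (t i.+1) w - W (t i) w),
      forall s t : R, 0 <= s -> s < t -> forall A : set R, measurable A ->
        P ((fun w : Omega => W t w - W s w) @^-1` A)
        = normal_prob 0 (Num.sqrt (t - s)) A
    & continuous_paths W].

Definition brownian_motion (R : realType) (d : measure_display)
    (Omega : measurableType d) (P : probability Omega R)
    (B : R -> {RV P >-> R}) : Prop :=
  exists W : R -> {RV P >-> R},
    [/\ standard_brownian_motion W,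
        independent_of_process (B 0) W
      & forall (t : R) (w : Omega), 0 <= t -> B t w = B 0 w + W t w].

(* The degenerate law has to be listed separately, because [normal_prob 0 0]
   is not the Dirac mass at 0. *)
Definition centered_normal (R : realType) (d : measure_display)
    (Omega : measurableType d) (P : probability Omega R)
    (X : Omega -> R) : Prop :=
  {ae P, forall w : Omega, X w = 0} \/
  exists2 sigma : R, 0 < sigma &
    forall A : set R, measurable A -> P (X @^-1` A) = normal_prob 0 sigma A.

Definition centered_gaussian_process (R : realType) (d : measure_display)
    (Omega : measurableType d) (P : probability Omega R)
    (X : R -> {RV P >-> R}) : Prop :=
  forall (n : nat) (t c : 'I_n -> R), (forall i : 'I_n, 0 <= t i) ->
    centered_normal P (fun w : Omega => \sum_(i < n) c i * X (t i) w).

Definition rho (R : realType) (d : measure_display)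
    (Omega : measurableType d) (P : probability Omega R)
    (B : R -> {RV P >-> R}) (alpha : R) (q : R -> R) (u : R -> R -> R)
    (s t : R) : R :=
  (fine (P [set w | B s w <= q s /\ B t w <= q t]) - alpha ^+ 2)
  / (u (q s) s * u (q t) t).

(* Main.v *)
Require Import Defs.
From HB Require Import structures.
From mathcomp Require Import all_boot all_order all_algebra.
From mathcomp Require Import all_classical all_reals all_analysis.
From mathcomp Require Import measurable_realfun ring lra.

(** The idea. Let [v t] be the density of [B t] and [G t] its distribution
    function. They are the averages of the density and the distribution function
    at time 0 against a normal law of variance [t] ([marginal_blur]). As the density
    at time 0 has two bounded derivatives, [G t] and [v t] satisfy first order
    Taylor estimates with a constant that does not depend on [t] ([taylor1_blur]),
    and both are Lipschitz in time ([blur_sqrt_sub]): in an expansion in powers of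
    the normal variable, the term of order one has mean zero, and the term of order
    two is proportional to the elapsed time. It follows that the quantile [q t] is
    Lipschitz in time ([quantile_lipschitz]) and that the density at the quantile
    stays away from 0 on bounded time intervals ([density_along_quantile_lb]).

    The increment of [B] between [s] and [t] is [sqrt (t - s) * Z], where [Z] is
    standard normal and independent of [B s] ([brownian_indep]). Therefore the
    probability that [B s <= q s] and [B t <= q t] is the mean of
    [G s (min (q s) (q t - sqrt (t - s) * Z))] ([marginal_joint]). Replace [t] by
    [t' > t]. The quantile [q t] is within [O (t - s)] of [q s], so the minimum is
    [q s - sqrt (t - s) * max 0 Z] up to negligible terms, and the probability
    decreases by [v s (q s) * (sqrt (t' - s) - sqrt (t - s)) * E (max 0 Z)],
    up to an error [O (t' - t)] ([joint_increment]). This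
    comparison is made for each value of [Z]; no kernel is differentiated.

    Dividing by the densities at the quantiles changes this by [O (t' - t)] only
    ([correlation_increment]). Finally
    [sqrt (t' - s) - sqrt (t - s) = (t' - t) / (sqrt (t' - s) + sqrt (t - s))] lies
    between [(t' - t) / (2 * sqrt (t' - s))] and [(t' - t) / (2 * sqrt (t - s))]
    ([sqrt_diff]), which gives the two bounds when [t' - s] is small enough for the
    singular term to dominate the error ([correlation_estimate]). *)

Set Implicit Arguments.
Unset Strict Implicit.
Unset Printing Implicit Defensive.

Import Order.TTheory GRing.Theory Num.Theory.
Import numFieldNormedType.Exports.

Local Open Scope classical_set_scope.
Local Open Scope ring_scope.

(** * The standard normal law *)

Section Gaussian.
Context {R : realType}.
Local Notation mu := (@lebesgue_measure R).
Local Notation gauss := (@normal_prob R 0 1).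

(** The density is a Radon-Nikodym derivative of the normal law, and such
    derivatives agree almost everywhere, so integration against the law is
    integration of the function times the density. *)
Lemma ge0_integral_normal_prob (s : R) (h : R -> \bar R) :
  measurable_fun setT h -> (forall z, 0 <= h z)%E ->
  (\int[normal_prob 0 s]_z h z = \int[mu]_z (h z * (normal_pdf 0 s z)%:E))%E.
Proof.
move=> mh h0.
have dom := normal_prob_dominates 0 s.
rewrite -(Radon_Nikodym_SigmaFinite.change_of_variables dom h0 measurableT mh).
have mpdf : measurable_fun setT (fun z => (normal_pdf 0 s z)%:E).
  by apply/measurable_EFinP; exact: measurable_normal_pdf.
have mRN := measurable_int _ (Radon_Nikodym_SigmaFinite.f_integrable dom).
apply: ae_eq_integral => //; [exact: emeasurable_funM|exact: emeasurable_funM|].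
apply: ae_eqe_mul2l; apply: integral_ae_eq => //.
  exact: Radon_Nikodym_SigmaFinite.f_integrable.
by move=> E _ mE; rewrite -Radon_Nikodym_SigmaFinite.f_integral.
Qed.

(** The gap between the two Gaussian exponents is 1/2 - 1/8 = 3/8, and
    t * exp(- t) <= 1 at t = 3/8 * z^2 absorbs the quadratic factor. *)
Lemma sqr_normal_pdf_le (z : R) :
  z ^+ 2 * normal_pdf 0 1 z
  <= 8 / 3 * (normal_peak 1 / normal_peak 2) * normal_pdf 0 2 z.
Proof.
have p1 : 0 < normal_peak (1 : R) by rewrite normal_peak_gt0// oner_neq0.
have p2 : 0 < normal_peak (2 : R) by rewrite normal_peak_gt0// pnatr_eq0.
rewrite !normal_pdfE ?oner_neq0 ?pnatr_eq0// /normal_fun subr0.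
set a := expR _; set b := expR _.
have ab : a = b * expR (- (3 / 8 * z ^+ 2)).
  by rewrite /a /b -expRD; congr expR; field.
have : 3 / 8 * z ^+ 2 * expR (- (3 / 8 * z ^+ 2)) <= 1.
  rewrite expRN ler_pdivrMr ?expR_gt0// mul1r.
  by apply: le_trans (expR_ge1Dx _); rewrite lerDr.
set e := expR _ in ab *; have b0 : 0 < b by exact: expR_gt0.
move=> le1; rewrite ab.
have -> : 8 / 3 * (normal_peak 1 / normal_peak 2) * (normal_peak 2 * b) =
  normal_peak (1 : R) * b * (8 / 3).
  by field; rewrite gt_eqF.
have -> : z ^+ 2 * (normal_peak 1 * (b * e)) =
  normal_peak (1 : R) * b * (8 / 3) * (3 / 8 * z ^+ 2 * e) by field.
by rewrite ler_piMr// !mulr_ge0// ?ltW// divr_ge0.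
Qed.

Lemma integrable_gauss_sqr : gauss.-integrable setT (fun z : R => (z ^+ 2)%:E).
Proof.
apply/integrableP; split.
  by apply/measurable_EFinP; exact: measurable_funX.
under eq_integral do rewrite /= ger0_norm ?sqr_ge0//.
rewrite ge0_integral_normal_prob/=; last 2 first.
- by apply/measurable_EFinP; exact: measurable_funX.
- by move=> z; rewrite lee_fin sqr_ge0.
set c := 8 / 3 * (normal_peak (1 : R) / normal_peak 2).
have c0 : 0 <= c by rewrite !mulr_ge0 ?invr_ge0 ?normal_peak_ge0.
apply: (@le_lt_trans _ _ (\int[mu]_z (c%:E * (normal_pdf 0 2 z)%:E))%E).
  apply: ge0_le_integral => //.
  - by move=> z _; rewrite mule_ge0// lee_fin ?sqr_ge0 ?normal_pdf_ge0.
  - apply: emeasurable_funM; apply/measurable_EFinP; first exact: measurable_funX.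
    exact: measurable_normal_pdf.
  - by apply: emeasurable_funM => //; apply/measurable_EFinP; exact: measurable_normal_pdf.
  - by move=> z _; rewrite -!EFinM lee_fin; exact: sqr_normal_pdf_le.
rewrite ge0_integralZl//; last 2 first.
- by apply/measurable_EFinP; exact: measurable_normal_pdf.
- by move=> z _; rewrite lee_fin normal_pdf_ge0.
by rewrite integral_normal_pdf mule1 ltry.
Qed.

(** Quadratic growth is the only integrability criterion used below: every
    integrand is a remainder of order two in the Gaussian variable. *)
Lemma integrable_gauss (h : R -> R) (C : R) : measurable_fun setT h ->
  (forall z, `|h z| <= C * (1 + z ^+ 2)) ->
  gauss.-integrable setT (EFin \o h).
Proof.
move=> mh hC.
have iC : gauss.-integrable setT (fun z : R => (C * (1 + z ^+ 2))%:E).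
  rewrite (_ : (fun _ => _) = (fun z : R => C%:E * ((cst 1%E z) + (z ^+ 2)%:E))%E).
    apply: integrableZl => //; apply: integrableD => //.
      exact: finite_measure_integrable_cst.
    exact: integrable_gauss_sqr.
  by apply/funext => z /=; rewrite -EFinD -EFinM.
apply: (le_integrable measurableT _ _ iC); first exact/measurable_EFinP.
by move=> z _ /=; rewrite lee_fin (le_trans (hC z))// ler_norm.
Qed.

Lemma lebesgue_measure_scale (s : R) (A : set R) : 0 < s -> measurable A ->
  pushforward mu (fun z => s * z : measurableTypeR R) A = (s^-1%:E * mu A)%E.
Proof.
move=> s0 mA.
pose sc := fun z : measurableTypeR R => s * z : measurableTypeR R.
have msc : measurable_fun setT sc by exact: measurable_funM.
pose mu' : {measure set (measurableTypeR R) -> \bar R} :=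
  mscale (NngNum (ltW s0)) (pushforward mu sc).
suff -> : mu A = mu' msc A.
  by rewrite /mu' /mscale/= muleA -EFinM mulVf ?gt_eqF// mul1e.
apply: lebesgue_measure_unique => //= _ [[a b]] _ <-.
rewrite /mu' /mscale /= /pushforward /sc.
have -> : (fun z => s * z) @^-1` `]a, b] = `]a / s, b / s]%classic.
  by apply/seteqP; split => z /=; rewrite !in_itv/= ltr_pdivrMr// ler_pdivlMr// ![_ * s]mulrC.
rewrite !lebesgue_measure_itv/= !lte_fin ltr_pM2r ?invr_gt0//.
case: ifPn => _; last by rewrite mule0.
by rewrite -!EFinB -EFinM; congr (_%:E); field; rewrite gt_eqF.
Qed.

(** All centered normal laws are images of one standard normal variable Z. This
    coupling turns a comparison between two times into a pointwise comparison of
    functions of Z. *)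
Lemma normal_prob_scale (s : R) (A : set R) : 0 < s -> measurable A ->
  normal_prob 0 s A = gauss ((fun z => s * z) @^-1` A).
Proof.
move=> s0 mA; pose sc := fun z : measurableTypeR R => s * z : measurableTypeR R.
have msc : measurable_fun setT sc by exact: measurable_funM.
rewrite /normal_prob.
have pdfE z : normal_pdf 0 1 z = s * normal_pdf 0 s (s * z).
  rewrite !normal_pdfE ?oner_neq0 ?gt_eqF// /normal_fun /normal_peak !subr0.
  rewrite expr1n mul1r -mulrnAr sqrtrM ?sqr_ge0// sqrtr_sqr gtr0_norm// mulrA.
  rewrite invfM mulrA mulfV ?gt_eqF// mul1r; congr (_ * expR _).
  by field; rewrite gt_eqF.
under [RHS]eq_integral do rewrite pdfE.
have mpdf : measurable_fun setT (fun z => (s * normal_pdf 0 s z)%:E).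
  by apply/measurable_EFinP; apply: measurable_funM => //; exact: measurable_normal_pdf.
rewrite -[RHS](@ge0_integral_pushforward _ _ _ _ _ _ msc mu A
    (fun z => (s * normal_pdf 0 s z)%:E))//; last 2 first.
- exact: measurable_funTS.
- by move=> z _; rewrite lee_fin mulr_ge0 ?normal_pdf_ge0// ltW.
have si0 : 0 <= s^-1 by rewrite invr_ge0 ltW.
rewrite [RHS](@eq_measure_integral _ _ _ _ (mscale (NngNum si0) mu)); last first.
  by move=> B mB _; exact: (lebesgue_measure_scale s0 mB).
rewrite ge0_integral_mscale//; last 2 first.
- exact: measurable_funTS.
- by move=> z _; rewrite lee_fin mulr_ge0 ?normal_pdf_ge0// ltW.
under [in RHS]eq_integral do rewrite EFinM.
rewrite ge0_integralZl//=; last 3 first.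
- by apply/measurable_EFinP; apply: measurable_funTS; exact: measurable_normal_pdf.
- by move=> z _; rewrite lee_fin normal_pdf_ge0.
- by rewrite lee_fin ltW.
by rewrite muleA -EFinM mulVf ?gt_eqF// mul1e.
Qed.

Lemma gauss_opp (A : set R) : measurable A ->
  gauss ((fun z => - z) @^-1` A) = gauss A.
Proof.
move=> mA; pose op := fun z : measurableTypeR R => - z : measurableTypeR R.
have mop : measurable_fun setT op by exact: measurable_funN.
rewrite /normal_prob.
have pdfE z : normal_pdf 0 1 z = normal_pdf 0 1 (- z) :> R.
  by rewrite !normal_pdfE ?oner_neq0// /normal_fun !subr0 sqrrN.
under eq_integral do rewrite pdfE.
have mpdf : measurable_fun setT (fun z : R => (normal_pdf 0 1 z)%:E).
  by apply/measurable_EFinP; exact: measurable_normal_pdf.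
rewrite -(@ge0_integral_pushforward _ _ _ _ _ _ mop mu A
    (fun z => (normal_pdf 0 1 z)%:E))//; last 2 first.
- exact: measurable_funTS.
- by move=> z _; rewrite lee_fin normal_pdf_ge0.
by apply: eq_measure_integral => B mB _; exact: lebesgue_measureN.
Qed.

Lemma ge0_integral_normal_prob_scale (s : R) (h : R -> \bar R) : 0 < s ->
  measurable_fun setT h -> (forall z, 0 <= h z)%E ->
  (\int[normal_prob 0 s]_z h z = \int[gauss]_z h (s * z)%R)%E.
Proof.
move=> s0 mh h0; pose sc := fun z : measurableTypeR R => s * z : measurableTypeR R.
have msc : measurable_fun setT sc by exact: measurable_funM.
have h0' : {in [set: measurableTypeR R], forall z, 0 <= h z}%E by [].
have e := @ge0_integral_pushforward _ _ _ _ _ _ msc gauss setT h measurableT mh h0'.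
rewrite preimage_setT in e.
transitivity (\int[pushforward gauss sc]_z h z)%E; last exact: e.
apply: eq_measure_integral => B mB _; exact: normal_prob_scale.
Qed.

Lemma norm_le_quad (z : R) : `|z| <= 1 + z ^+ 2.
Proof.
have := sqr_ge0 (`|z| - 1); rewrite sqrrB real_normK ?num_real// expr1n mulr1.
by have := sqr_ge0 z; have := normr_ge0 z; lra.
Qed.

Lemma integrable_gauss_id : gauss.-integrable setT (fun z : R => z%:E).
Proof.
apply: (@integrable_gauss id 1) => // z; rewrite mul1r; exact: norm_le_quad.
Qed.

Lemma integrable_affine (a b : R) :
  gauss.-integrable setT (fun z : R => (a + b * z)%:E).
Proof.
have ia : gauss.-integrable setT (EFin \o cst a).
  exact: finite_measure_integrable_cst.
have ib := integrableZl measurableT b integrable_gauss_id.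
by have := integrableD measurableT ia ib; exact: eq_integrable.
Qed.

(** By symmetry of the law under negation. *)
Lemma gauss_mean0 : \int[gauss]_z (z : R) = 0.
Proof.
suff : \int[gauss]_z (z : R) = - \int[gauss]_z (z : R) by lra.
pose op := fun z : measurableTypeR R => - z : measurableTypeR R.
have mop : measurable_fun setT op by exact: measurable_funN.
rewrite /Rintegral -fineN -integralN/=; last exact/integrable_add_def/integrable_gauss_id.
congr fine.
have io : gauss.-integrable (op @^-1` setT) ((fun z : R => z%:E) \o op).
  rewrite preimage_setT.
  exact: (eq_integrable measurableT _ _ _ (integrableN integrable_gauss_id)).
have mE : measurable_fun setT (fun z : R => z%:E) by exact/measurable_EFinP.
have e := @integral_pushforward _ _ _ _ _ _ mop gauss setT (fun z => z%:E)
  mE io measurableT.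
rewrite preimage_setT in e.
transitivity (\int[pushforward gauss op]_z z%:E)%E; last exact: e.
by apply: eq_measure_integral => B mB _; exact/esym/gauss_opp.
Qed.

Definition gmean (h : R -> R) : R := \int[gauss]_z h z.

Lemma gmean_affine (a b : R) : gmean (fun z => a + b * z) = a.
Proof.
have ib : gauss.-integrable setT (fun z : R => (b * z)%:E).
  by have := integrableZl measurableT b integrable_gauss_id; exact: eq_integrable.
have ia : gauss.-integrable setT (EFin \o cst a).
  exact: finite_measure_integrable_cst.
rewrite /gmean; transitivity (\int[gauss]_z (cst a z) + \int[gauss]_z (b * z)).
  exact: RintegralD.
rewrite RintegralZl//; last exact: integrable_gauss_id.
rewrite gauss_mean0 mulr0 addr0 Rintegral_cst//= -[RHS]mulr1; congr (_ * _).
by have -> : normal_prob 0 1 setT = 1%E :> \bar R by exact: probability_setT.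
Qed.

Lemma gmean_le (h k : R -> R) : gauss.-integrable setT (EFin \o h) ->
  gauss.-integrable setT (EFin \o k) -> (forall z, h z <= k z) ->
  gmean h <= gmean k.
Proof. by move=> ih ik hk; apply: le_Rintegral. Qed.

Definition gmoment : R := gmean (fun z => 1 + z ^+ 2).

Lemma integrable_gauss_quad (C : R) :
  gauss.-integrable setT (fun z : R => (C * (1 + z ^+ 2))%:E).
Proof.
apply: (@integrable_gauss _ `|C|) => [|z].
  by apply: measurable_funM => //; apply: measurable_funD => //; exact: measurable_funX.
by rewrite normrM ler_wpM2l// ger0_norm// addr_ge0// sqr_ge0.
Qed.

Lemma gmean_quad (C : R) : gmean (fun z => C * (1 + z ^+ 2)) = C * gmoment.
Proof.
rewrite /gmean RintegralZl//; have := integrable_gauss_quad 1.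
by apply: eq_integrable => // z _; rewrite mul1r.
Qed.

Lemma gmoment_ge1 : 1 <= gmoment.
Proof.
rewrite -[leLHS](gmean_affine 1 0) /gmoment; apply: gmean_le => [||z].
- apply: (@integrable_gauss _ 1) => [|z]; first exact: measurable_funD.
  by rewrite mul0r addr0 normr1 mul1r lerDl sqr_ge0.
- by have := integrable_gauss_quad 1; apply: eq_integrable => // z _; rewrite mul1r.
- by rewrite mul0r addr0 lerDl sqr_ge0.
Qed.

Lemma integrable_gauss_near (C : R) (h k : R -> R) : measurable_fun setT h ->
  gauss.-integrable setT (EFin \o k) ->
  (forall z, `|h z - k z| <= C * (1 + z ^+ 2)) ->
  gauss.-integrable setT (EFin \o h).
Proof.
move=> mh ik hk.
have mk : measurable_fun setT k by case/integrableP: ik => /measurable_EFinP.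
have : gauss.-integrable setT (EFin \o (fun z => h z - k z)).
  by apply: integrable_gauss hk; exact: measurable_funB.
move/(integrableD measurableT)/(_ ik); apply: eq_integrable => // z _ /=.
by rewrite -EFinD subrK.
Qed.

(** The way every error term is estimated: a pointwise error that is quadratic in
    the Gaussian variable gives an error of the same size between the means. *)
Lemma gmean_near (C : R) (h k : R -> R) : measurable_fun setT h ->
  gauss.-integrable setT (EFin \o k) ->
  (forall z, `|h z - k z| <= C * (1 + z ^+ 2)) ->
  `|gmean h - gmean k| <= C * gmoment.
Proof.
move=> mh ik hk; have ih := integrable_gauss_near mh ik hk.
rewrite /gmean -RintegralB//; apply: (le_trans (le_normr_Rintegral _ _)) => //.
  by have := integrableB measurableT ih ik; apply: eq_integrable.
rewrite -gmean_quad; apply: gmean_le => //; last exact: integrable_gauss_quad.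
have := integrableB measurableT ih ik => /integrable_norm.
by apply: eq_integrable.
Qed.

Lemma normal_pdf_lb (a b z : R) : a < z < b ->
  normal_peak 1 * expR (- (a ^+ 2 + b ^+ 2)) <= normal_pdf 0 1 z.
Proof.
move=> /andP[az zb]; rewrite normal_pdfE ?oner_neq0// ler_wpM2l ?normal_peak_ge0//.
rewrite /normal_fun subr0 ler_expR expr1n mulNr lerN2.
have : z ^+ 2 <= a ^+ 2 + b ^+ 2 by have [z0|z0] := leP 0 z; nra.
have := sqr_ge0 a; have := sqr_ge0 b; lra.
Qed.

(** The density is bounded below on a bounded interval, hence the interval has
    positive mass. *)
Lemma gmean_gt0 (h : R -> R) (a b e : R) : gauss.-integrable setT (EFin \o h) ->
  (forall z, 0 <= h z) -> a < b -> 0 < e -> (forall z, a < z < b -> e <= h z) ->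
  0 < gmean h.
Proof.
move=> ih h0 ab e0 he.
have mh : measurable_fun setT h by case/integrableP: ih => /measurable_EFinP.
have ifin : (\int[gauss]_z (h z)%:E)%E \is a fin_num by exact: integrable_fin_num ih.
rewrite -lte_fin /gmean /Rintegral fineK//.
have mEh : measurable_fun setT (fun z => (h z)%:E) by exact/measurable_EFinP.
rewrite (ge0_integral_normal_prob _ mEh) => [|z]; last by rewrite lee_fin.
set c := normal_peak 1 * expR (- (a ^+ 2 + b ^+ 2)) : R.
have c0 : 0 < c by rewrite mulr_gt0 ?expR_gt0// normal_peak_gt0// oner_neq0.
have mint : measurable_fun setT (fun z => (h z)%:E * (normal_pdf 0 1 z)%:E)%E.
  apply: emeasurable_funM; apply/measurable_EFinP => //.
  exact: measurable_normal_pdf.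
apply: (@lt_le_trans _ _ (\int[mu]_(z in `]a, b[) (e * c)%:E)%E).
  rewrite integral_cst//= lebesgue_measure_itv/= lte_fin ab.
  rewrite -EFinB -EFinM lte_fin; apply: mulr_gt0; last by rewrite subr_gt0.
  exact: mulr_gt0.
apply: (@le_trans _ _ (\int[mu]_(z in `]a, b[) ((h z)%:E * (normal_pdf 0 1 z)%:E))%E).
  apply: ge0_le_integral => //.
  - by move=> z _; rewrite lee_fin mulr_ge0 ?ltW.
  - exact: measurable_funTS.
  - move=> z /=; rewrite in_itv/= => zab; rewrite -EFinM lee_fin.
    by apply: ler_pM; rewrite ?(ltW e0) ?(ltW c0)// ?he// normal_pdf_lb.
apply: ge0_subset_integral => //.
by move=> z _; rewrite mule_ge0// lee_fin ?normal_pdf_ge0.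
Qed.

(** The mean of the positive part of a standard normal variable, that is
    1 / sqrt (2 pi). It is the coefficient of the singular term. *)
Definition gpos : R := gmean (fun z => Num.max 0 z).

Lemma integrable_gauss_pos : gauss.-integrable setT (fun z : R => (Num.max 0 z)%:E).
Proof.
apply: (@integrable_gauss _ 1) => [|z]; first exact: measurable_maxr.
have := sqr_ge0 z; have := sqr_ge0 (z - 1).
by case: (leP 0 z) => z0; rewrite ?normr0 ?ger0_norm//; nra.
Qed.

Lemma gpos_gt0 : 0 < gpos.
Proof.
apply: (@gmean_gt0 _ 1 2 1) => //.
- exact: integrable_gauss_pos.
- by move=> z; rewrite le_max lexx.
- by rewrite ltr1n.
- by move=> z /andP[/ltW z1 _]; rewrite le_max z1 orbT.
Qed.

Lemma gmean_affine_pos (a b : R) :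
  gmean (fun z => a + b * Num.max 0 z) = a + b * gpos /\
  gauss.-integrable setT (fun z : R => (a + b * Num.max 0 z)%:E).
Proof.
have ia : gauss.-integrable setT (EFin \o cst a).
  exact: finite_measure_integrable_cst.
have ib : gauss.-integrable setT (fun z : R => (b * Num.max 0 z)%:E).
  by have := integrableZl measurableT b integrable_gauss_pos; exact: eq_integrable.
split; last by have := integrableD measurableT ia ib; exact: eq_integrable.
rewrite /gmean; transitivity (\int[gauss]_z (cst a z) + \int[gauss]_z (b * Num.max 0 z)).
  exact: RintegralD.
rewrite RintegralZl//; last exact: integrable_gauss_pos.
rewrite Rintegral_cst//=.
have -> : normal_prob 0 1 setT = 1%E :> \bar R by exact: probability_setT.
by rewrite mulr1.
Qed.
End Gaussian.

(** * Taylor estimates and Gaussian averages *)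

Section Smoothing.
Context {R : realType}.
Local Notation gauss := (@normal_prob R 0 1).

(** [psi] is the derivative of [phi] and is [K]-Lipschitz. Both facts are written
    as inequalities because inequalities survive averaging with the same
    constant, without differentiating under the integral. *)
Definition taylor1 (K : R) (phi psi : R -> R) : Prop :=
  (forall x y, `|phi y - phi x - psi x * (y - x)| <= K * (y - x) ^+ 2) /\
  (forall x y, `|psi y - psi x| <= K * `|y - x|).

Lemma lipschitz_of_derive (K : R) (phi psi : R -> R) :
  (forall x : R, is_derive x 1 phi (psi x)) -> (forall x, `|psi x| <= K) ->
  forall x y, `|phi y - phi x| <= K * `|y - x|.
Proof.
move=> dphi psiK.
have main x y : x < y -> `|phi y - phi x| <= K * `|y - x|.
  move=> xy; have [|c _ ->] := @MVT _ phi psi x y xy.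
    apply: derivable_within_continuous => z _; exact: (@ex_derive _ _ _ _ _ _ _ (dphi z)).
    by rewrite normrM ler_wpM2r.
move=> x y; have [xy|yx|->] := ltgtP x y; first exact: main.
- by rewrite distrC [X in _ * X]distrC; exact: main.
- by rewrite !subrr normr0 mulr0.
Qed.

Lemma taylor1_of_derive (K : R) (phi psi dpsi : R -> R) :
  (forall x : R, is_derive x 1 phi (psi x)) ->
  (forall x : R, is_derive x 1 psi (dpsi x)) -> (forall x, `|dpsi x| <= K) ->
  taylor1 K phi psi.
Proof.
move=> dphi ddpsi dpsiK.
have psiK := lipschitz_of_derive ddpsi dpsiK.
have K0 : 0 <= K by exact: le_trans (dpsiK 0).
split=> // x y.
have cphi a b : {within `[a, b], continuous phi}.
  apply: derivable_within_continuous => z _.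
  exact: (@ex_derive _ _ _ _ _ _ _ (dphi z)).
have bound c : `|c - x| <= `|y - x| ->
    `|psi c * (y - x) - psi x * (y - x)| <= K * (y - x) ^+ 2.
  move=> cx; rewrite -mulrBl normrM -[(y - x) ^+ 2]real_normK ?num_real// expr2 mulrA.
  by rewrite ler_wpM2r// (le_trans (psiK _ _))// ler_wpM2l.
have [xy|yx|->] := ltgtP x y; last first.
- by rewrite !subrr mulr0 subr0 normr0 expr0n mulr0.
- have [|c /[!in_itv]/= /andP[yc cx] e] := @MVT _ phi psi y x yx.
    exact: cphi.
  have -> : phi y - phi x = psi c * (y - x) by rewrite -opprB e -mulrN opprB.
  by apply: bound; rewrite !ler0_norm; lra.
- have [|c /[!in_itv]/= /andP[xc cy] ->] := @MVT _ phi psi x y xy.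
    exact: cphi.
  by apply: bound; rewrite !ger0_norm; lra.
Qed.

(** Increments between two points near [x], linearized at the common base point
    [x] instead of at one of the end points. *)
Lemma taylor1_incr (K : R) (phi psi : R -> R) : taylor1 K phi psi ->
  forall x a b, `|phi b - phi a - psi x * (b - a)|
                <= K * ((b - a) ^+ 2 + `|a - x| * `|b - a|).
Proof.
move=> [h1 h2] x a b.
have -> : phi b - phi a - psi x * (b - a) =
  (phi b - phi a - psi a * (b - a)) + (psi a - psi x) * (b - a) by ring.
rewrite (le_trans (ler_normD _ _))// [leRHS]mulrDr lerD// normrM mulrA ler_wpM2r//.
Qed.

Lemma locally_lipschitz_continuous (h : R -> R) (x r L : R) : 0 < r -> 0 <= L ->
  (forall y, `|y - x| < r -> `|h y - h x| <= L * `|y - x|) ->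
  {for x, continuous h}.
Proof.
move=> r0 L0 hL; apply/cvgrPdist_lt => e e0; near=> y.
have yx : `|y - x| < r.
  by near: y; apply/nbhs_ballP; exists r => //= z; rewrite /ball/= distrC.
rewrite distrC; apply: (le_lt_trans (hL _ yx)).
have : `|y - x| < e / (L + 1).
  near: y; apply/nbhs_ballP; exists (e / (L + 1)) => //=; first by rewrite divr_gt0// ltr_wpDl.
  by move=> z; rewrite /ball/= distrC.
rewrite ltr_pdivlMr ?ltr_wpDl// => yxe.
by rewrite (le_lt_trans _ yxe)// mulrC ler_wpM2l// lerDl.
Unshelve. all: by end_near. Qed.

Lemma taylor1_continuous (K : R) (phi psi : R -> R) : 0 <= K -> taylor1 K phi psi ->
  continuous phi /\ continuous psi.
Proof.
move=> K0 [h1 h2]; split=> x; last first.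
  by apply: (@locally_lipschitz_continuous _ _ 1 K).
apply: (@locally_lipschitz_continuous _ _ 1 (K + `|psi x|)) => //.
  by rewrite addr_ge0.
move=> y yx.
have -> : phi y - phi x = (phi y - phi x - psi x * (y - x)) + psi x * (y - x).
  by ring.
rewrite (le_trans (ler_normD _ _))// mulrDl lerD ?normrM//.
apply: (le_trans (h1 _ _)); rewrite ler_wpM2l// -real_normK ?num_real// expr2.
by rewrite ler_piMr// ltW.
Qed.

Lemma gmean_bound (C : R) (h : R -> R) : gauss.-integrable setT (EFin \o h) ->
  (forall z, `|h z| <= C) -> `|gmean h| <= C.
Proof.
move=> ih hC; rewrite -[leRHS](gmean_affine C 0).
apply: (le_trans (le_normr_Rintegral _ _)) => //; apply: gmean_le => //.
- by have := integrable_norm ih; apply: eq_integrable.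
- apply: (eq_integrable measurableT (EFin \o cst C)).
    by move=> z _; rewrite /= mul0r addr0.
  exact: finite_measure_integrable_cst.
- by move=> z; rewrite mul0r addr0.
Qed.

(** The function of [x] obtained by adding an independent normal variable of
    standard deviation [s]: it turns the distribution function, the density and
    its derivative at time 0 into those at time [s ^+ 2]. *)
Definition blur (s : R) (phi : R -> R) (x : R) : R := gmean (fun z => phi (x - s * z)).

Lemma measurable_shift (s x : R) (phi : R -> R) : measurable_fun setT phi ->
  measurable_fun setT (fun z => phi (x - s * z)).
Proof.
move=> mphi; apply: (measurableT_comp mphi).
by apply: measurable_funB => //; exact: measurable_funM.
Qed.

(** Both functions are within a quadratic error of an affine function. *)
Lemma integrable_blur (K s x : R) (phi psi : R -> R) : 0 <= K -> taylor1 K phi psi ->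
  gauss.-integrable setT (EFin \o (fun z : R => phi (x - s * z))) /\
  gauss.-integrable setT (EFin \o (fun z : R => psi (x - s * z))).
Proof.
move=> K0 h; have [cphi cpsi] := taylor1_continuous K0 h.
have [h1 h2] := h; split.
- apply: (@integrable_gauss_near _ (K * s ^+ 2) _ (fun z => phi x + (- (psi x * s)) * z)).
  + by apply: measurable_shift; exact: continuous_measurable_fun.
  + exact: integrable_affine.
  + move=> z; have := h1 x (x - s * z).
    have -> : phi (x - s * z) - (phi x + - (psi x * s) * z) =
      phi (x - s * z) - phi x - psi x * (x - s * z - x) by ring.
    move=> /le_trans; apply.
    rewrite addrAC subrr sub0r sqrrN exprMn mulrA; apply: ler_wpM2l.
      by rewrite mulr_ge0// sqr_ge0.
    by rewrite lerDr.
- apply: (@integrable_gauss_near _ (K * `|s|) _ (fun z => psi x + 0 * z)).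
  + by apply: measurable_shift; exact: continuous_measurable_fun.
  + exact: integrable_affine.
  + move=> z; rewrite mul0r addr0; apply: (le_trans (h2 _ _)).
    rewrite addrAC subrr sub0r normrN normrM mulrA; apply: ler_wpM2l; first exact: mulr_ge0.
    exact: norm_le_quad.
Qed.

Lemma taylor1_blur (K s : R) (phi psi : R -> R) : 0 <= K -> taylor1 K phi psi ->
  taylor1 K (blur s phi) (blur s psi).
Proof.
move=> K0 h; have [h1 h2] := h.
have i1 x := (integrable_blur s x K0 h).1; have i2 x := (integrable_blur s x K0 h).2.
have ishift x y z : y - s * z - (x - s * z) = y - x by ring.
split=> x y; last first.
  rewrite /blur /gmean -RintegralB; [|by []|exact: i2|exact: i2].
  rewrite -/(gmean _); apply: gmean_bound.
    by have := integrableB measurableT (i2 y) (i2 x); apply: eq_integrable.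
  by move=> z; have := h2 (x - s * z) (y - s * z); rewrite ishift.
have iB := integrableB measurableT (i1 y) (i1 x).
have iZ := integrableZr measurableT (y - x) (i2 x).
rewrite /blur /gmean -RintegralB; [|by []|exact: i1|exact: i1].
rewrite -RintegralZr; [|by []|exact: i2].
rewrite -RintegralB; [|by []|exact: iB|exact: iZ].
rewrite -/(gmean _).
apply: gmean_bound.
  by have := integrableB measurableT iB iZ; apply: eq_integrable.
by move=> z; have := h1 (x - s * z) (y - s * z); rewrite ishift.
Qed.

(** The term of order one in the Gaussian variable is odd and has mean zero, so
    only the term of order two remains. Its coefficient [s' * (s' - s)] is at
    most [s' ^+ 2 - s ^+ 2], the elapsed time. *)
Lemma blur_sub (K x s s' : R) (phi psi : R -> R) : 0 <= K -> taylor1 K phi psi ->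
  0 <= s <= s' ->
  `|blur s' phi x - blur s phi x| <= K * (s' * (s' - s)) * gmoment.
Proof.
move=> K0 h /andP[s0 ss'].
have i1 a := (integrable_blur a x K0 h).1.
have -> : blur s' phi x - blur s phi x =
  gmean (fun z => phi (x - s' * z) - phi (x - s * z))
  - gmean (fun z => 0 + (- psi x * (s' - s)) * z).
  by rewrite gmean_affine subr0 /blur /gmean RintegralB.
apply: gmean_near.
- apply: measurable_funB; apply: measurable_shift; apply: continuous_measurable_fun;
  exact: (taylor1_continuous K0 h).1.
- exact: integrable_affine.
- move=> z; have := taylor1_incr h x (x - s * z) (x - s' * z).
  have -> : x - s' * z - (x - s * z) = - ((s' - s) * z) by ring.
  have -> : x - s * z - x = - (s * z) by ring.
  rewrite !normrN !normrM (ger0_norm s0) [`|s' - s|]ger0_norm ?subr_ge0//.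
  have -> : phi (x - s' * z) - phi (x - s * z) - psi x * - ((s' - s) * z) =
    phi (x - s' * z) - phi (x - s * z) - (0 + - psi x * (s' - s) * z) by ring.
  move=> /le_trans; apply.
  have -> : (- ((s' - s) * z)) ^+ 2 + s * `|z| * ((s' - s) * `|z|) =
      (s' - s) ^+ 2 * z ^+ 2 + s * (s' - s) * (`|z| ^+ 2) by ring.
  rewrite real_normK ?num_real// -mulrDl.
  have -> : (s' - s) ^+ 2 + s * (s' - s) = s' * (s' - s) by ring.
  rewrite mulrA; apply: ler_wpM2l; last by rewrite lerDr.
  by apply: mulr_ge0 => //; apply: mulr_ge0; [exact: le_trans ss'|rewrite subr_ge0].
Qed.

Lemma blur_sqrt_sub (K x t t' : R) (phi psi : R -> R) : 0 <= K -> taylor1 K phi psi ->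
  0 <= t -> 0 <= t' ->
  `|blur (Num.sqrt t') phi x - blur (Num.sqrt t) phi x| <= K * gmoment * `|t' - t|.
Proof.
move=> K0 h; wlog tt' : t t' / t <= t'.
  move=> H t0 t'0; have [/H|/ltW/H] := leP t t'; first exact.
  by rewrite distrC [X in _ <= _ * X]distrC; exact.
move=> t0 t'0; apply: (le_trans (blur_sub x K0 h _)).
  by rewrite sqrtr_ge0 ler_wsqrtr.
rewrite [leLHS]mulrAC; apply: ler_wpM2l.
  by rewrite mulr_ge0// (le_trans ler01)// gmoment_ge1.
rewrite ger0_norm ?subr_ge0// mulrBr -expr2 sqr_sqrtr// lerB//.
by rewrite -[leLHS](sqr_sqrtr t0) expr2 ler_wpM2r ?sqrtr_ge0 ?ler_wsqrtr.
Qed.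
End Smoothing.

(** * The quantile curve and the increments of the covariance *)

Lemma min_dist_le (R : realType) (c x y : R) :
  `|Num.min c x - Num.min c y| <= `|x - y|.
Proof.
have hx := ler_norm (x - y); have := ler_norm (y - x).
rewrite [`|y - x|]distrC => hy.
by case: (leP c x) => h1; case: (leP c y) => h2; rewrite ler_norml; lra.
Qed.

(** If the two arguments of the minima lie on the same side of 0 as [- z], the
    left-hand side vanishes. Otherwise the sign of [a] interferes, which forces
    [`|z| <= `|a| / s <= L * s]. *)
Lemma min_affine_diff (R : realType) (L a s s' z : R) :
  0 < s -> s <= s' -> `|a| <= L * s ^+ 2 ->
  `|Num.min 0 (a - s' * z) - Num.min 0 (a - s * z) + (s' - s) * Num.max 0 z|
  <= (s' - s) * (L * s).
Proof.
move=> s0 ss'; rewrite expr2 mulrA ler_norml => /andP[aL1 aL2].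
have d0 : 0 <= s' - s by rewrite subr_ge0.
have small y : s * y <= L * s * s -> (s' - s) * y <= (s' - s) * (L * s).
  by rewrite mulrC ler_pM2r// => yL; rewrite ler_wpM2l.
have L0 : 0 <= (s' - s) * (L * s).
  by rewrite mulr_ge0// -(pmulr_lge0 _ s0); lra.
have -> : a - s' * z = (a - s * z) - (s' - s) * z by ring.
have [z0|z0] := leP 0 z.
  have dz : 0 <= (s' - s) * z by rewrite mulr_ge0.
  have [A0|A0] := leP 0 (a - s * z); have [B0|B0] := leP 0 (a - s * z - (s' - s) * z);
    rewrite ler_norml.
  - have := small z; move/(_ ltac:(lra)); lra.
  - have := small z; move/(_ ltac:(lra)); lra.
  - lra.
  - lra.
have dz : 0 <= (s' - s) * (- z) by rewrite mulr_ge0// oppr_ge0 ltW.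
rewrite mulr0 addr0; rewrite mulrN in dz.
have sN : s * - z <= L * s * s -> - ((s' - s) * z) <= (s' - s) * (L * s).
  by move/small; rewrite mulrN.
rewrite mulrN in sN.
have [A0|A0] := leP 0 (a - s * z); have [B0|B0] := leP 0 (a - s * z - (s' - s) * z);
    rewrite ler_norml.
- lra.
- lra.
- have := sN ltac:(lra); lra.
- have := sN ltac:(lra); lra.
Qed.

Section QuantileCurve.
Context {R : realType}.
Variables (alpha K : R) (G v : R -> R -> R) (q : R -> R).
Hypothesis K0 : 0 < K.
Hypothesis G_taylor : forall t : R, 0 <= t -> taylor1 K (G t) (v t).
Hypothesis G_homo : forall t x y : R, 0 <= t -> x <= y -> G t x <= G t y.
Hypothesis G_time : forall t t' x : R, 0 <= t -> 0 <= t' ->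
  `|G t' x - G t x| <= K * `|t' - t|.
Hypothesis v_time : forall t t' x : R, 0 <= t -> 0 <= t' ->
  `|v t' x - v t x| <= K * `|t' - t|.
Hypothesis G_q : forall t : R, 0 <= t -> G t (q t) = alpha.
Hypothesis v_q_gt0 : forall t : R, 0 <= t -> 0 < v t (q t).

(** Moving by [e = 4 * K / c * `|t' - t|] from the quantile at time [t] changes
    the distribution function by at least [c * e / 2 = 2 * K * `|t' - t|], as long
    as the curvature term [K * e ^+ 2] is at most half of [c * e]; passing to time
    [t'] changes it by at most [K * `|t' - t|]. So the quantile at time [t'] is
    caught between the two points. *)
Lemma quantile_lipschitz (c t t' : R) : 0 < c -> 0 <= t -> 0 <= t' ->
  c <= v t (q t) -> `|t' - t| <= c ^+ 2 / (8 * K ^+ 2) ->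
  `|q t' - q t| <= 4 * K / c * `|t' - t|.
Proof.
move=> c0 t0 t'0 cv tt'.
have [->|ntt'] := eqVneq t' t; first by rewrite !subrr normr0 mulr0.
have d0 : 0 < `|t' - t| by rewrite normr_gt0 subr_eq0.
set d := `|t' - t| in tt' d0 *; set e := 4 * K / c * d.
have e0 : 0 < e by rewrite !mulr_gt0// invr_gt0.
have ce : c * e = 4 * K * d by rewrite /e; field; rewrite gt_eqF.
(* this is where the bound on the time step is used *)
have Ke : K * e <= c / 2.
  rewrite -(ler_pM2l c0) mulrCA ce.
  have -> : K * (4 * K * d) = 4 * K ^+ 2 * d by ring.
  rewrite ler_pdivlMr in tt'; last by rewrite mulr_gt0// exprn_gt0.
  have -> : c * (c / 2) = c ^+ 2 / 2 by field.
  lra.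
have Kee : K * e ^+ 2 <= c * e / 2.
  by have := ler_wpM2r (ltW e0) Ke; rewrite expr2; lra.
have [h _] := G_taylor t0; have vq := v_q_gt0 t0.
have up : q t' <= q t + e.
  rewrite leNgt; apply/negP => /ltW /(G_homo t'0); rewrite (G_q t'0).
  have := h (q t) (q t + e); have := G_time (q t + e) t0 t'0.
  have -> : q t + e - q t = e by ring.
  rewrite (G_q t0) -/d.
  move: (ler_wpM2r (ltW e0) cv) => cve.
  rewrite !ler_norml => /andP[h1 h2] /andP[h3 h4].
  have Kd : 0 < K * d by rewrite mulr_gt0.
  lra.
have dn : q t - e <= q t'.
  rewrite leNgt; apply/negP => /ltW /(G_homo t'0); rewrite (G_q t'0).
  have := h (q t) (q t - e); have := G_time (q t - e) t0 t'0.
  have -> : q t - e - q t = - e by ring.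
  rewrite (G_q t0) -/d sqrrN mulrN.
  move: (ler_wpM2r (ltW e0) cv) => cve.
  rewrite !ler_norml => /andP[h1 h2] /andP[h3 h4].
  have Kd : 0 < K * d by rewrite mulr_gt0.
  lra.
by rewrite ler_norml; lra.
Qed.

Lemma density_along_quantile (c t t' : R) : 0 < c -> 0 <= t -> 0 <= t' ->
  c <= v t (q t) -> `|t' - t| <= c ^+ 2 / (8 * K ^+ 2) ->
  `|v t' (q t') - v t (q t)| <= (K + K * (4 * K / c)) * `|t' - t|.
Proof.
move=> c0 t0 t'0 cv tt'; have ql := quantile_lipschitz c0 t0 t'0 cv tt'.
have -> : v t' (q t') - v t (q t) =
  (v t' (q t') - v t (q t')) + (v t (q t') - v t (q t)) by ring.
rewrite (le_trans (ler_normD _ _))// [leRHS]mulrDl lerD ?v_time//.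
have [_ h] := G_taylor t0.
by rewrite (le_trans (h _ _))// -mulrA ler_wpM2l// ltW.
Qed.

(** A compactness argument: the density at the quantile is positive and, by the
    local Lipschitz bounds, continuous in time. Evaluating it at [`|t|] makes it
    continuous on the whole line. *)
Lemma density_along_quantile_lb (T : R) : 0 <= T ->
  exists2 c, 0 < c & forall t : R, 0 <= t <= T -> c <= v t (q t).
Proof.
move=> T0; pose w (t : R) : R := v `|t| (q `|t|).
have cw : continuous w.
  move=> t; have n0 := normr_ge0 t; have p := v_q_gt0 n0.
  apply: (@locally_lipschitz_continuous _ w t
    (w t ^+ 2 / (8 * K ^+ 2)) (K + K * (4 * K / w t))).
  - by rewrite divr_gt0 ?exprn_gt0// mulr_gt0// exprn_gt0.
  - by rewrite addr_ge0 ?ltW// mulr_gt0// divr_gt0// mulr_gt0.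
  - move=> y yt; have ny := ler_dist_dist y t.
    apply: (le_trans (density_along_quantile p n0 (normr_ge0 y) (lexx _) _)).
      exact: le_trans (ltW yt).
    by rewrite ler_wpM2l// addr_ge0 ?ltW// mulr_gt0// divr_gt0// mulr_gt0.
have [|t0 _ t0min] := @EVT_min _ w 0 T T0; first exact: continuous_subspaceT.
exists (w t0); first exact: v_q_gt0.
move=> t /andP[t1 t2]; have := t0min t; rewrite in_itv/= t1 t2 => /(_ isT).
by rewrite {2}/w ger0_norm.
Qed.

Hypothesis G_01 : forall t x : R, 0 <= t -> 0 <= G t x <= 1.
Hypothesis v_le : forall t x : R, 0 <= t -> v t x <= K.
Hypothesis alpha_01 : 0 < alpha < 1.

Local Notation gauss := (@normal_prob R 0 1).

(** The probability of being below both quantiles: given the path up to time [s],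
    the increment up to time [t] is [sqrt (t - s)] times a standard normal
    variable. *)
Definition joint (s t : R) : R :=
  gmean (fun z => G s (Num.min (q s) (q t - Num.sqrt (t - s) * z))).

Lemma measurable_joint (s t r : R) : 0 <= s ->
  measurable_fun setT (fun z => G s (Num.min (q s) (q t - r * z))).
Proof.
move=> s0; have [cG _] := taylor1_continuous (ltW K0) (G_taylor s0).
apply: (measurableT_comp (continuous_measurable_fun cG)).
apply: measurable_minr => //.
by apply: measurable_funB => //; exact: measurable_funM.
Qed.

Lemma integrable_joint (s t r : R) : 0 <= s ->
  gauss.-integrable setT
    (EFin \o (fun z => G s (Num.min (q s) (q t - r * z)))).
Proof.
move=> s0; apply: (@integrable_gauss _ _ 1); first exact: measurable_joint.
move=> z; have /andP[h0 h1] := G_01 (Num.min (q s) (q t - r * z)) s0.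
by rewrite ger0_norm// mul1r (le_trans h1)// lerDl sqr_ge0.
Qed.

Lemma joint_01 (s t : R) : 0 <= s -> `|joint s t - alpha ^+ 2| <= 1.
Proof.
move=> s0; have ij := integrable_joint t (Num.sqrt (t - s)) s0.
have i1 : gauss.-integrable setT (EFin \o cst (1 : R)).
  exact: finite_measure_integrable_cst.
have j0 : 0 <= joint s t.
  apply: Rintegral_ge0 => z _.
  by have /andP[] := G_01 (Num.min (q s) (q t - Num.sqrt (t - s) * z)) s0.
have j1 : `|joint s t| <= 1.
  apply: gmean_bound => // z.
  have /andP[h0 h1] := G_01 (Num.min (q s) (q t - Num.sqrt (t - s) * z)) s0.
  by rewrite ger0_norm.
rewrite ger0_norm// in j1; rewrite ler_norml.
have : 0 <= alpha ^+ 2 <= 1.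
  by have /andP[a0 a1] := alpha_01; rewrite sqr_ge0 expr_le1 ?ltW.
lra.
Qed.

(** The heart of the matter, pointwise in the Gaussian variable [z]. The two
    values of [G s] are compared through its linearization at [q s], where [G s]
    has slope [v s (q s)]. The quantiles move by [O (t - s)],
    which is negligible with respect to [sqrt (t - s) * z], so the minimum
    decreases by about [(sqrt (t' - s) - sqrt (t - s)) * max 0 z]. Every error is
    of the order of the elapsed time [t' - t]. *)
Lemma joint_integrand_increment (L s t t' z : R) :
  0 <= s -> s < t -> t < t' -> t - s <= 1 -> t' - t <= 1 -> 0 <= L ->
  `|q t - q s| <= L * (t - s) -> `|q t' - q t| <= L * (t' - t) ->
  `|G s (Num.min (q s) (q t' - Num.sqrt (t' - s) * z))
    - G s (Num.min (q s) (q t - Num.sqrt (t - s) * z))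
    - (0 + - (v s (q s) * (Num.sqrt (t' - s) - Num.sqrt (t - s))) * Num.max 0 z)|
  <= 3 * K * (1 + L) ^+ 2 * (t' - t) * (1 + z ^+ 2).
Proof.
move=> s0 st tt' ts1 tt1 L0 qL qL'; have vq := v_q_gt0 s0; have vK := v_le (q s) s0.
set r := Num.sqrt (t - s); set r' := Num.sqrt (t' - s); set V := v s (q s) in vq vK *.
have r0 : 0 < r by rewrite sqrtr_gt0 subr_gt0.
have rr' : r <= r' by rewrite ler_wsqrtr// lerD2r ltW.
have rE : r ^+ 2 = t - s by rewrite sqr_sqrtr// subr_ge0 ltW.
have r'E : r' ^+ 2 = t' - s by rewrite sqr_sqrtr// subr_ge0 ltW// (lt_trans st).
have r1 : r <= 1 by rewrite -(@ler_pXn2r _ 2) ?nnegrE ?(ltW r0)// expr1n rE.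
set e := t' - t in tt1 qL' *; have e0 : 0 < e by rewrite subr_gt0.
have eE : e = (r' - r) * (r' + r) by rewrite -subr_sqr rE r'E /e; ring.
set b := Num.min (q s) (q t' - r' * z); set a := Num.min (q s) (q t - r * z).
set d := r' - r in eE *; have d0 : 0 <= d by rewrite subr_ge0.
(* increments of the square root turn into elapsed time once they are
   multiplied by a square root *)
have dd : d ^+ 2 <= e by rewrite eE expr2 ler_wpM2l// /d; lra.
have rd : r * d <= e by rewrite eE mulrC ler_wpM2l// /d; lra.
pose y := `|z|; have y0 : 0 <= y by exact: normr_ge0.
have yy : 2 * y <= 1 + z ^+ 2.
  have := sqr_ge0 (y - 1); rewrite sqrrB /y real_normK ?num_real// expr1n mulr1; lra.
have y2 : y ^+ 2 = z ^+ 2 by rewrite /y real_normK ?num_real.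
have ba : `|b - a| <= L * e + d * y.
  apply: (le_trans (min_dist_le _ _ _)).
  have -> : q t' - r' * z - (q t - r * z) = (q t' - q t) + - (d * z) by rewrite /d; ring.
  by rewrite (le_trans (ler_normD _ _))// normrN normrM (ger0_norm d0) lerD2r.
have aq : `|a - q s| <= L * r ^+ 2 + r * y.
  have -> : `|a - q s| = `|a - Num.min (q s) (q s)| by rewrite minxx.
  apply: (le_trans (min_dist_le _ _ _)).
  have -> : q t - r * z - q s = (q t - q s) + - (r * z) by ring.
  by rewrite (le_trans (ler_normD _ _))// normrN normrM (ger0_norm (ltW r0)) lerD2r rE.
have ba2 : (b - a) ^+ 2 <= 2 * e * (L ^+ 2 + z ^+ 2).
  rewrite -real_normK ?num_real//.
  apply: (@le_trans _ _ ((L * e + d * y) ^+ 2)).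
    by rewrite ler_pXn2r// nnegrE (le_trans _ ba).
  have := sqr_ge0 (L * e - d * y).
  have : (L * e) ^+ 2 <= e * L ^+ 2.
    by rewrite exprMn mulrC [e ^+ 2]expr2 -mulrA ler_wpM2l ?(ltW e0)// ler_piMl// sqr_ge0.
  have : (d * y) ^+ 2 <= e * z ^+ 2 by rewrite exprMn y2 ler_wpM2r// sqr_ge0.
  by rewrite sqrrB sqrrD; lra.
have aqba : `|a - q s| * `|b - a| <= e * (L ^+ 2 + 2 * L * y + z ^+ 2).
  apply: (le_trans (ler_pM (normr_ge0 _) (normr_ge0 _) aq ba)).
  have h1 : r ^+ 2 * (L ^+ 2 * e) <= 1 * (L ^+ 2 * e).
    by rewrite ler_wpM2r// ?expr_le1 ?(ltW r0)// mulr_ge0 ?sqr_ge0// ltW.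
  have h2 : r * d * (L * r * y) <= e * (L * r * y).
    by rewrite ler_wpM2r// !mulr_ge0// ltW.
  have h3 : r * (e * L * y) <= 1 * (e * L * y).
    by rewrite ler_wpM2r// !mulr_ge0// ltW.
  have h4 : r * d * y ^+ 2 <= e * y ^+ 2 by rewrite ler_wpM2r// sqr_ge0.
  rewrite y2 in h4.
  have -> : (L * r ^+ 2 + r * y) * (L * e + d * y) =
    r ^+ 2 * (L ^+ 2 * e) + r * d * (L * r * y) + r * (e * L * y) + r * d * y ^+ 2 by ring.
  by rewrite y2; lra.
have lin : `|b - a + d * Num.max 0 z| <= 2 * L * e.
  have m0 x : Num.min (q s) x = q s + Num.min 0 (x - q s).
    by rewrite addr_minr addr0 addrC subrK.
  have -> : b - a + d * Num.max 0 z =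
     (Num.min (q s) (q t' - r' * z) - Num.min (q s) (q t - r' * z)) +
     (Num.min 0 ((q t - q s) - r' * z) - Num.min 0 ((q t - q s) - r * z) + d * Num.max 0 z).
    rewrite /b /a !m0.
    have -> : q t - r' * z - q s = q t - q s - r' * z by ring.
    have -> : q t - r * z - q s = q t - q s - r * z by ring.
    by ring.
  apply: (le_trans (ler_normD _ _)).
  have h1 : `|Num.min (q s) (q t' - r' * z) - Num.min (q s) (q t - r' * z)| <= L * e.
    by apply: (le_trans (min_dist_le _ _ _)); rewrite opprD addrACA subrr addr0.
  have qLr : `|q t - q s| <= L * r ^+ 2 by rewrite rE.
  have h2 := min_affine_diff z r0 rr' qLr; rewrite -/d in h2.
  have h3 : d * (L * r) <= L * e by rewrite mulrCA ler_wpM2l// mulrC.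
  lra.
have T := taylor1_incr (G_taylor s0) (q s) a b; rewrite -/V in T.
have -> : G s b - G s a - (0 + - (V * d) * Num.max 0 z) =
   (G s b - G s a - V * (b - a)) + V * (b - a + d * Num.max 0 z) by ring.
apply: (le_trans (ler_normD _ _)).
have h1 : `|V * (b - a + d * Num.max 0 z)| <= K * (2 * L * e).
  by rewrite normrM (ger0_norm (ltW vq)) ler_pM// ltW.
have h2 : K * ((b - a) ^+ 2 + `|a - q s| * `|b - a|) <=
    K * (2 * e * (L ^+ 2 + z ^+ 2) + e * (L ^+ 2 + 2 * L * y + z ^+ 2)).
  by rewrite ler_wpM2l ?(ltW K0)// lerD.
apply: (le_trans (lerD T (le_refl _))).
apply: (le_trans (lerD h2 h1)).
have Ke : 0 <= K * e by rewrite mulr_ge0// ltW.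
have -> : K * (2 * e * (L ^+ 2 + z ^+ 2) + e * (L ^+ 2 + 2 * L * y + z ^+ 2)) +
  K * (2 * L * e) = K * e * (3 * L ^+ 2 + 3 * z ^+ 2 + L * (2 * y) + 2 * L) by ring.
have -> : 3 * K * (1 + L) ^+ 2 * e * (1 + z ^+ 2) =
  K * e * (3 * (1 + L) ^+ 2 * (1 + z ^+ 2)) by ring.
rewrite ler_wpM2l//.
have := ler_wpM2l L0 yy.
have := mulr_ge0 (sqr_ge0 L) (sqr_ge0 z); have := mulr_ge0 L0 (sqr_ge0 z).
have := sqr_ge0 z; rewrite sqrrD; lra.
Qed.

Lemma joint_increment (L s t t' : R) :
  0 <= s -> s < t -> t < t' -> t - s <= 1 -> t' - t <= 1 -> 0 <= L ->
  `|q t - q s| <= L * (t - s) -> `|q t' - q t| <= L * (t' - t) ->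
  `|joint s t' - joint s t + v s (q s) * (Num.sqrt (t' - s) - Num.sqrt (t - s)) * gpos|
  <= 3 * K * (1 + L) ^+ 2 * (t' - t) * gmoment.
Proof.
move=> s0 st tt' ts1 tt1 L0 qL qL'.
set V := v s (q s) * _.
have [ge gi] := @gmean_affine_pos R 0 (- V).
have -> : joint s t' - joint s t + V * gpos =
  gmean (fun z => G s (Num.min (q s) (q t' - Num.sqrt (t' - s) * z))
    - G s (Num.min (q s) (q t - Num.sqrt (t - s) * z)))
  - gmean (fun z => 0 + - V * Num.max 0 z).
  rewrite ge /gmean RintegralB; [|by []|exact: integrable_joint|exact: integrable_joint].
  by rewrite /joint /gmean; ring.
apply: gmean_near => //.
  by apply: measurable_funB; exact: measurable_joint.
by move=> z; exact: joint_integrand_increment.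
Qed.

(** The covariance of the Gaussian process, with distribution functions and
    densities replaced by the abstract [G] and [v]. *)
Definition correlation (s t : R) : R :=
  (joint s t - alpha ^+ 2) / (v s (q s) * v t (q t)).

(** The density in the denominator is Lipschitz in time, so it contributes only to
    the error; the numerator contributes the singular term, in which the density
    [v s (q s)] cancels. *)
Lemma correlation_increment (c L s t t' : R) : 0 < c -> 0 <= L ->
  0 <= s -> s < t -> t < t' -> t - s <= 1 -> t' - t <= 1 ->
  c <= v s (q s) -> c <= v t (q t) -> c <= v t' (q t') ->
  `|q t - q s| <= L * (t - s) -> `|q t' - q t| <= L * (t' - t) ->
  `|correlation s t' - correlation s t
    + gpos / v t' (q t') * (Num.sqrt (t' - s) - Num.sqrt (t - s))|
  <= (3 * K * (1 + L) ^+ 2 * gmoment / c ^+ 2 + K * (1 + L) / c ^+ 3) * (t' - t).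
Proof.
move=> c0 L0 s0 st tt' ts1 tt1 cs ct ct' qL qL'.
have hJ := joint_increment s0 st tt' ts1 tt1 L0 qL qL'.
have t0 : 0 <= t by exact: le_trans s0 (ltW st).
have t'0 : 0 <= t' by exact: le_trans t0 (ltW tt').
have hj := joint_01 t s0.
have hv : `|v t (q t) - v t' (q t')| <= K * (1 + L) * (t' - t).
  rewrite distrC.
  have -> : v t' (q t') - v t (q t) =
    (v t' (q t') - v t (q t')) + (v t (q t') - v t (q t)) by ring.
  apply: (le_trans (ler_normD _ _)); rewrite (mulrDr K) mulr1 [leRHS]mulrDl lerD//.
    by apply: (le_trans (v_time _ _ _)); rewrite // ger0_norm// subr_ge0 ltW.
  have [_ h] := G_taylor t0.
  by apply: (le_trans (h _ _)); rewrite -mulrA ler_wpM2l// ltW.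
rewrite /correlation.
set A := v s (q s) in cs hJ *; set B := v t (q t) in ct hv *.
set C := v t' (q t') in ct' hv *; set J := joint s t in hj hJ *.
set J' := joint s t' in hJ *.
set d := Num.sqrt (t' - s) - Num.sqrt (t - s) in hJ *.
have A0 : 0 < A by exact: lt_le_trans cs.
have B0 : 0 < B by exact: lt_le_trans ct.
have C0 : 0 < C by exact: lt_le_trans ct'.
have -> : (J' - alpha ^+ 2) / (A * C) - (J - alpha ^+ 2) / (A * B) + gpos / C * d =
  (J' - J + A * d * gpos) / (A * C) + (J - alpha ^+ 2) * (B - C) / (A * B * C).
  by field; rewrite !gt_eqF.
apply: (le_trans (ler_normD _ _)); rewrite [leRHS]mulrDl.
have cAC : c ^+ 2 <= A * C by rewrite expr2 ler_pM// ltW.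
have cABC : c ^+ 3 <= A * B * C by rewrite exprSr expr2 !ler_pM ?mulr_ge0// ltW.
rewrite !normrM !normfV !normrM !(gtr0_norm A0) (gtr0_norm B0) (gtr0_norm C0).
apply: lerD.
  rewrite [leRHS]mulrAC [X in _ <= X / _]mulrAC; apply: ler_pM => //.
    by rewrite invr_ge0 mulr_ge0// ltW.
  by rewrite lef_pV2// posrE ?mulr_gt0// exprn_gt0.
rewrite [leRHS]mulrAC; apply: ler_pM => //.
- by rewrite invr_ge0 !mulr_ge0// ltW.
- by rewrite -[leRHS]mul1r; apply: ler_pM.
- by rewrite lef_pV2// posrE ?mulr_gt0// exprn_gt0.
Qed.

Lemma powR_Nhalf (x : R) : 0 < x -> x `^ (- 2^-1) = (Num.sqrt x)^-1.
Proof. by move=> x0; rewrite powRN powR12_sqrt// ltW. Qed.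

Lemma sqrt_diff (s t t' : R) : s < t -> t < t' ->
  (t' - t) / (2 * Num.sqrt (t' - s)) <= Num.sqrt (t' - s) - Num.sqrt (t - s)
    <= (t' - t) / (2 * Num.sqrt (t - s)).
Proof.
move=> st tt'.
set r := Num.sqrt (t - s); set r' := Num.sqrt (t' - s).
have r0 : 0 < r by rewrite sqrtr_gt0 subr_gt0.
have rr' : r <= r' by rewrite ler_wsqrtr// lerD2r ltW.
have r'0 : 0 < r' by exact: lt_le_trans rr'.
have -> : t' - t = (r' - r) * (r' + r).
  rewrite -subr_sqr !sqr_sqrtr ?subr_ge0 ?ltW//; first by ring.
  exact: lt_trans tt'.
have d0 : 0 <= r' - r by rewrite subr_ge0.
rewrite ler_pdivrMr ?mulr_gt0// ler_pdivlMr ?mulr_gt0//.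
by rewrite !ler_wpM2l//; lra.
Qed.

(** The singular term is [(t' - t) / (sqrt (t' - s) + sqrt (t - s))] up to a
    constant, which lies between the two bounds. The error is [D * (t' - t)], and
    it is a fraction of the singular term as soon as [sqrt (t' - s) <= h]. *)
Lemma correlation_estimate (T : R) : 0 < T ->
  exists delta C1 C2 : R, [/\ 0 < delta, 0 < C1, 0 < C2 &
    forall s t dt : R, 0 <= s -> s < t -> t <= T -> 0 < dt ->
      `|t - s| < delta -> dt < delta ->
      - C2 * `|t - s| `^ (- 2^-1) * dt <= correlation s (t + dt) - correlation s t
        <= - C1 * `|t + dt - s| `^ (- 2^-1) * dt].
Proof.
move=> T0.
have [c c0 hc] := @density_along_quantile_lb (T + 1) (addr_ge0 (ltW T0) ler01).
pose L := 4 * K / c; have L0 : 0 <= L by rewrite !mulr_ge0 ?invr_ge0// ltW.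
pose rr := c ^+ 2 / (8 * K ^+ 2).
have rr0 : 0 < rr by rewrite divr_gt0 ?exprn_gt0// mulr_gt0// exprn_gt0.
pose D := 3 * K * (1 + L) ^+ 2 * gmoment / c ^+ 2 + K * (1 + L) / c ^+ 3.
have D0 : 0 <= D.
  have g0 : 0 <= @gmoment R by rewrite (le_trans ler01)// gmoment_ge1.
  have L1 : 0 <= 1 + L by rewrite addr_ge0.
  by rewrite addr_ge0// divr_ge0 ?exprn_ge0 ?(ltW c0)// !mulr_ge0 ?exprn_ge0// ltW.
have g0 := @gpos_gt0 R.
(* half of the lower bound [gpos / (2 * K)] of the singular coefficient is kept,
   the other half pays for the error term *)
pose m := gpos / (4 * K) : R; have m0 : 0 < m by rewrite divr_gt0// mulr_gt0.
pose h := m / (D + 1); have h0 : 0 < h by rewrite divr_gt0// ltr_wpDl.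
pose delta := Num.min (2^-1) (Num.min rr (h ^+ 2 / 2)).
have delta0 : 0 < delta.
  by rewrite !lt_min rr0 invr_gt0 ltr0n divr_gt0// exprn_gt0.
exists delta, m, (gpos / (2 * c) + D); split=> //.
  by rewrite ltr_wpDr// divr_gt0// mulr_gt0.
move=> s t dt s0 st tT dt0 tsd dtd.
have t0 : 0 < t by exact: le_lt_trans st.
rewrite gtr0_norm ?subr_gt0// in tsd *.
have tds : 0 < t + dt - s by lra.
rewrite (gtr0_norm tds) (powR_Nhalf tds) powR_Nhalf ?subr_gt0//.
move: tsd dtd; rewrite !lt_min => /and3P[ts1 ts2 ts3] /and3P[dt1 dt2 dt3].
have cs : c <= v s (q s) by apply: hc; lra.
have ct : c <= v t (q t) by apply: hc; lra.
have ct' : c <= v (t + dt) (q (t + dt)) by apply: hc; lra.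
have tdt0 : 0 <= t + dt by lra.
have qL : `|q t - q s| <= L * (t - s).
  have := quantile_lipschitz c0 s0 (ltW t0) cs.
  by rewrite gtr0_norm ?subr_gt0//; apply; exact: ltW.
have qL' : `|q (t + dt) - q t| <= L * (t + dt - t).
  have := quantile_lipschitz c0 (ltW t0) tdt0 ct.
  by rewrite addrAC subrr add0r gtr0_norm//; apply; exact: ltW.
have tdt : t < t + dt by rewrite ltrDl.
have := correlation_increment c0 L0 s0 st tdt _ _ cs ct ct' qL qL'.
rewrite -/D => H; have := H ltac:(lra) ltac:(lra); rewrite {H}.
have := sqrt_diff st tdt.
have -> : t + dt - t = dt by ring.
set r := Num.sqrt (t - s); set r' := Num.sqrt _; set V := v (t + dt) _ in ct' *.
have r0 : 0 < r by rewrite sqrtr_gt0 subr_gt0.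
have r'0 : 0 < r' by rewrite sqrtr_gt0.
have r1 : r <= 1.
  by rewrite -(@ler_pXn2r _ 2) ?nnegrE ?(ltW r0)// expr1n sqr_sqrtr; lra.
have r'h : r' <= h.
  by rewrite -(@ler_pXn2r _ 2) ?nnegrE ?(ltW r'0) ?(ltW h0)// sqr_sqrtr; lra.
have V0 : 0 < V by exact: lt_le_trans ct'.
have VK : V <= K by exact: v_le.
set e := r' - r; move=> /andP[e1 e2]; rewrite ler_norml => /andP[b1 b2].
have dtr : 0 <= dt / r by rewrite divr_ge0// ltW.
have dtr' : 0 <= dt / r' by rewrite divr_ge0// ltW.
have gV1 : 4 * m * e <= gpos / V * e.
  rewrite ler_wpM2r//; first by apply: le_trans e1; rewrite divr_ge0 ?ltW// mulr_gt0.
  have -> : 4 * m = gpos / K by rewrite /m; field; rewrite gt_eqF.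
  by rewrite ler_pM2l// lef_pV2// posrE.
have gV2 : gpos / V * e <= gpos / c * (dt / (2 * r)).
  apply: ler_pM => //; first by rewrite divr_ge0// ltW.
    by apply: le_trans e1; rewrite divr_ge0 ?ltW// mulr_gt0.
  by rewrite ler_pM2l// lef_pV2// posrE.
have half (x : R) : dt / (2 * x) = dt / x / 2 by rewrite invfM mulrA [dt / 2 / x]mulrAC.
rewrite !half in e1 e2 gV2.
have Dr' : D * dt <= m * (dt / r').
  have : D * r' <= m.
    apply: (@le_trans _ _ ((D + 1) * h)).
      by apply: ler_pM => //; [exact: ltW|rewrite lerDl].
    by rewrite /h mulrC divfK// gt_eqF// ltr_wpDl.
  move/(ler_wpM2r dtr'); have -> : D * r' * (dt / r') = D * dt by field; rewrite gt_eqF.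
  by [].
have Dr : D * dt <= D * (dt / r).
  by rewrite ler_wpM2l// ler_pdivlMr// ler_piMr// ltW.
have me := ler_wpM2l (ltW m0) e1.
have E1 : gpos / c * (dt / r / 2) = gpos / (2 * c) * (dt / r) by field; rewrite !gt_eqF.
rewrite E1 in gV2.
have -> : - (gpos / (2 * c) + D) * r^-1 * dt = - (gpos / (2 * c) * (dt / r)) - D * (dt / r).
  by field; rewrite !gt_eqF.
have -> : - m * r'^-1 * dt = - (m * (dt / r')) by ring.
lra.
Qed.
End QuantileCurve.

(** * Brownian motion with a random starting point *)

Section Independence.
Context {R : realType} {d : measure_display} {Omega : measurableType d}.
Variable P : probability Omega R.

Definition indep_rv (X Y : Omega -> R) : Prop :=
  forall A B : set R, measurable A -> measurable B ->
    P (X @^-1` A `&` Y @^-1` B) = (P (X @^-1` A) * P (Y @^-1` B))%E.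

Lemma measurable_pair (X Y : {RV P >-> R}) :
  measurable_fun setT (fun w => (X w, Y w)).
Proof. exact: measurable_fun_pair. Qed.

(** A measure on the plane is determined by its values on rectangles. *)
Lemma indep_pair (X Y : {RV P >-> R}) : indep_rv X Y ->
  forall S : set (R * R), measurable S ->
  P [set w | S (X w, Y w)] = (distribution P X \x distribution P Y)%E S.
Proof.
move=> ind S mS.
pose m' : {measure set (R * R) -> \bar R} := pushforward P (fun w => (X w, Y w)).
rewrite (@product_measure_unique _ _ _ _ _ (distribution P X) (distribution P Y)
  (m' (measurable_pair X Y)))// => A B mA mB; exact: ind.
Qed.

(** Conditioning on an event of [Z] of positive probability does not change the
    law of the pair [(X, Y)], as is seen on rectangles. Hence it does not change
    the law of the sum. *)
Lemma indep_add (X Y Z : {RV P >-> R}) :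
  (forall A B C : set R, measurable A -> measurable B -> measurable C ->
    P (X @^-1` A `&` (Y @^-1` B `&` Z @^-1` C)) =
    (P (X @^-1` A) * (P (Y @^-1` B) * P (Z @^-1` C)))%E) ->
  indep_rv (fun w => X w + Y w) Z.
Proof.
move=> ind A C mA mC.
have indXY : indep_rv X Y.
  move=> A' B' mA' mB'; have := ind A' B' setT mA' mB' measurableT.
  by rewrite preimage_setT setIT probability_setT mule1.
pose S := [set p : R * R | A (p.1 + p.2)].
have mS : measurable S.
  rewrite -[S]setTI; have mD : measurable_fun setT (fun p : R * R => p.1 + p.2).
    by apply: measurable_funD.
  exact: mD.
have mZC : measurable (Z @^-1` C) by rewrite -[_ @^-1` _]setTI; exact: measurable_funP.
have mXY := measurable_pair X Y.
have mSX : measurable [set w | S (X w, Y w)].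
  by rewrite -[X in measurable X]setTI; exact: mXY.
have [PC0|PC0] := eqVneq (P (Z @^-1` C)) 0%E.
  rewrite PC0 mule0; apply/eqP; rewrite eq_le measure_ge0 andbT -PC0.
  by apply: le_measure; rewrite ?inE//; exact: measurableI.
pose c := fine (P (Z @^-1` C)).
have cE : P (Z @^-1` C) = c%:E by rewrite /c fineK// fin_num_measure.
have c0 : 0 < c by rewrite lt_neqAle eq_sym -eqe -cE PC0 /= -lee_fin -cE.
have ci0 : 0 <= c^-1 by rewrite invr_ge0 ltW.
pose m' : {measure set (R * R) -> \bar R} :=
  mscale (NngNum ci0) (pushforward (mrestr P mZC) (fun w => (X w, Y w))).
have m'E (A' B' : set R) : measurable A' -> measurable B' ->
    m' mXY (A' `*` B') = (distribution P X A' * distribution P Y B')%E.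
  move=> mA' mB'.
  transitivity (c^-1%:E * P (X @^-1` A' `&` (Y @^-1` B' `&` Z @^-1` C)))%E.
    by rewrite setIA.
  rewrite ind// cE (muleA (P (X @^-1` A'))) [(_ * c%:E)%E]muleC muleA -EFinM mulVf ?gt_eqF//.
  by rewrite mul1e.
have mS' := product_measure_unique m'E mS.
have : (P (Z @^-1` C) * m' mXY S = P ((fun w => (X w + Y w)%R) @^-1` A `&` Z @^-1` C))%E.
  rewrite cE /m' /mscale /= muleA -EFinM mulfV ?gt_eqF// mul1e.
  by [].
move=> <-; rewrite -mS' muleC; congr (_ * _)%E.
exact/esym/(indep_pair indXY).
Qed.

(** Fubini for a pair with one normal component, written with a standard normal
    variable. *)
Lemma indep_normal_mixture (X Y : {RV P >-> R}) (s : R) (S : set (R * R)) :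
  0 < s -> indep_rv X Y ->
  (forall A, measurable A -> P (Y @^-1` A) = normal_prob 0 s A) ->
  measurable S ->
  fine (P [set w | S (Y w, X w)])
  = gmean (fun z => fine (P [set w | S (s * z, X w)])).
Proof.
move=> s0 ind lawY mS.
have indYX : indep_rv Y X by move=> A B mA mB; rewrite setIC ind// muleC.
pose h (y : R) : \bar R := P [set w | S (y, X w)].
have hE : distribution P X \o xsection S = h.
  apply/funext => y; rewrite /h /= /distribution /pushforward; congr (P _).
  by apply/seteqP; split => w; rewrite /= xsectionE.
have mh : measurable_fun setT h.
  by rewrite -hE; exact: measurable_fun_xsection.
have h0 y : (0 <= h y)%E by exact: measure_ge0.
have hfin y : h y \is a fin_num.
  by rewrite -hE /=; apply: fin_num_measure; exact: measurable_xsection.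
rewrite (indep_pair indYX mS) /gmean /Rintegral; congr fine.
transitivity (\int[@normal_prob R 0 1]_z h (s * z)%R)%E; last first.
  by apply: eq_integral => z _; rewrite -/(h (s * z)) fineK.
rewrite -(ge0_integral_normal_prob_scale s0 mh)//.
rewrite /product_measure1 hE ge0_integral_distribution//.
pose Y' : Omega -> measurableTypeR R := Y.
have mY' : measurable_fun setT Y'.
  by move=> _ A mA; have := measurable_funPT Y measurableT A; apply.
rewrite -[LHS](@ge0_integral_pushforward _ _ _ _ _ _ mY' P setT h)//.
by apply: eq_measure_integral => A mA _; exact: lawY.
Qed.

Lemma indep_normal_cdf (X Y : {RV P >-> R}) (s x : R) : 0 < s -> indep_rv X Y ->
  (forall A, measurable A -> P (Y @^-1` A) = normal_prob 0 s A) ->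
  fine (P [set w | X w + Y w <= x])
  = blur s (fun y => fine (P [set w | X w <= y])) x.
Proof.
move=> s0 ind lawY; pose S := [set p : R * R | p.2 + p.1 <= x].
have mS : measurable S.
  have -> : S = (fun p => p.2 + p.1) @^-1` `]-oo, x].
    by apply/seteqP; split => p /=; rewrite !in_itv.
  rewrite -[X in measurable X]setTI.
  have mD : measurable_fun setT (fun p : R * R => p.2 + p.1) by apply: measurable_funD.
  exact: mD.
rewrite (indep_normal_mixture s0 ind lawY mS) /blur; congr gmean.
apply/funext => z; congr (fine (P _)).
by apply/seteqP; split => w /=; rewrite /S /= lerBrDr.
Qed.

Lemma indep_normal_joint_cdf (X Y : {RV P >-> R}) (s a b : R) : 0 < s ->
  indep_rv X Y ->
  (forall A, measurable A -> P (Y @^-1` A) = normal_prob 0 s A) ->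
  fine (P [set w | X w <= a /\ X w + Y w <= b]) =
  gmean (fun z => fine (P [set w | X w <= Num.min a (b - s * z)])).
Proof.
move=> s0 ind lawY.
pose S := [set p : R * R | p.2 <= a /\ p.2 + p.1 <= b].
have mS : measurable S.
  have -> : S = (snd @^-1` `]-oo, a]) `&` ((fun p => p.2 + p.1) @^-1` `]-oo, b]).
    by apply/seteqP; split => p /=; rewrite !in_itv.
  apply: measurableI; rewrite -[X in measurable X]setTI.
    by have := @measurable_snd _ _ R R; apply.
  have mD : measurable_fun setT (fun p : R * R => p.2 + p.1) by apply: measurable_funD.
  exact: mD.
rewrite (indep_normal_mixture s0 ind lawY mS); congr gmean.
apply/funext => z; congr (fine (P _)).
apply/seteqP; split => w; rewrite /= /S /= le_min lerBrDr.
  by move=> [-> ->].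
by move=> /andP[].
Qed.
End Independence.

Section Brownian.
Context {R : realType} {d : measure_display} {Omega : measurableType d}.
Variable P : probability Omega R.
Variables (B W : R -> {RV P >-> R}).
Hypothesis W_bm : standard_brownian_motion W.
Hypothesis B0_W : independent_of_process (B 0) W.
Hypothesis BE : forall (t : R) (w : Omega), 0 <= t -> B t w = B 0 w + W t w.

Definition process_events : set (set Omega) :=
  [set E | exists (t : R) (A : set R),
    [/\ 0 <= t, measurable A & E = W t @^-1` A]].

Definition incr (s t : R) : {RV P >-> R} := (W t \- W s)%R.

Lemma incrE (s t : R) (w : Omega) : 0 <= s -> 0 <= t ->
  B t w = B s w + incr s t w.
Proof. by move=> s0 t0; rewrite (BE _ s0) (BE _ t0) /incr /=; ring. Qed.

Lemma incr_law (s t : R) (A : set R) : 0 <= s -> s < t -> measurable A ->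
  P (incr s t @^-1` A) = normal_prob 0 (Num.sqrt (t - s)) A.
Proof. by case: W_bm => _ _ h _ s0 st mA; exact: h. Qed.

(** Independence of increments along the times 0, [s], [t], [t] and so on. *)
Lemma incr_indep (s t : R) : 0 <= s -> s < t -> indep_rv P (incr 0 s) (incr s t).
Proof.
move=> s0 st A C mA mC; case: W_bm => _ h _ _.
pose tt (i : nat) := if i is 0 then 0 else if i is 1 then s else t.
have := h 2%N tt (lexx _).
have tt_homo i : tt i <= tt i.+1.
  by case: i => [|[|i]] //=; exact: ltW.
pose AC (i : 'I_2) := if val i == 0%N then A else C.
move=> /(_ tt_homo AC); rewrite !big_ord_recl big_ord0 mule1 /= => <-; last first.
  by move=> i; rewrite /AC; case: ifP.
congr (P _); apply/seteqP; split => w /=.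
  move=> [wA wC] i _; rewrite /AC /=.
  by case: i => [[|[|i]] // hi] /=.
move=> h'; split.
  by have := h' ord0 I.
by have := h' ord_max I.
Qed.

Lemma incr_process (s t : R) (A : set R) : 0 <= s -> 0 <= t -> measurable A ->
  process_sigma W (incr s t @^-1` A).
Proof.
move=> s0 t0 mA.
have mW (r : R) : 0 <= r -> measurable_fun [set: g_sigma_algebraType process_events] (W r : _ -> R).
  move=> r0 _ D mD; rewrite setTI; apply: sub_sigma_algebra.
  by exists r, D.
have := measurable_funB (mW _ t0) (mW _ s0).
move=> /(_ measurableT A mA); rewrite setTI.
by [].
Qed.

(** [B s] is the sum of [B 0] and the increment over [[0, s]], and these two are
    jointly independent of the next increment. *)
Lemma brownian_indep (s t : R) : 0 <= s -> s < t -> indep_rv P (B s) (incr s t).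
Proof.
move=> s0 st; have t0 : 0 <= t by exact: le_trans s0 (ltW st).
have -> : (B s : Omega -> R) = (fun w => B 0 w + incr 0 s w).
  by apply/funext => w; exact: incrE.
apply: indep_add => A1 A2 A3 m1 m2 m3.
rewrite -(incr_indep s0 st m2 m3); apply: B0_W => //.
apply: (@measurableI _ (g_sigma_algebraType process_events)); exact: incr_process.
Qed.

Definition marginal (t x : R) : R := fine (P [set w | B t w <= x]).

Lemma marginal_blur (t x : R) : 0 <= t ->
  marginal t x = blur (Num.sqrt t) (marginal 0) x.
Proof.
rewrite le_eqVlt => /predU1P[<-|t0].
  rewrite sqrtr0 /blur -[LHS](gmean_affine _ 0); congr gmean.
  by apply/funext => z; rewrite !mul0r subr0 addr0.
have := @indep_normal_cdf _ _ _ P (B 0) (incr 0 t) (Num.sqrt t) x.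
rewrite sqrtr_gt0 => /(_ t0 (brownian_indep (lexx _) t0)).
have law A : measurable A -> P (incr 0 t @^-1` A) = normal_prob 0 (Num.sqrt t) A.
  by move=> mA; have := incr_law (lexx 0) t0 mA; rewrite subr0.
move=> /(_ law) <-; congr (fine (P _)).
by apply/seteqP; split => w /=; rewrite (incrE w (lexx 0) (ltW t0)).
Qed.

Lemma marginal_joint (s t a b : R) : 0 <= s -> s < t ->
  fine (P [set w | B s w <= a /\ B t w <= b]) =
  gmean (fun z => marginal s (Num.min a (b - Num.sqrt (t - s) * z))).
Proof.
move=> s0 st; have t0 : 0 <= t by exact: le_trans s0 (ltW st).
have := @indep_normal_joint_cdf _ _ _ P (B s) (incr s t) (Num.sqrt (t - s)) a b.
rewrite sqrtr_gt0 subr_gt0 => /(_ st (brownian_indep s0 st)).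
move=> /(_ (fun A => incr_law s0 st)) <-; congr (fine (P _)).
by apply/seteqP; split => w /=; rewrite (incrE w s0 t0).
Qed.

Lemma measurable_sublevel (t x : R) : measurable [set w | B t w <= x].
Proof.
rewrite -[X in measurable X]setTI.
have -> : [set w | B t w <= x] = B t @^-1` `]-oo, x].
  by apply/seteqP; split => w /=; rewrite in_itv.
exact: measurable_funPT.
Qed.

Lemma marginal_homo (t x y : R) : x <= y -> marginal t x <= marginal t y.
Proof.
move=> xy; rewrite /marginal; have m := measurable_sublevel t.
apply: fine_le; rewrite ?fin_num_measure//.
by apply: le_measure; rewrite ?inE// => w /= /le_trans; apply.
Qed.

Lemma marginal_01 (t x : R) : 0 <= marginal t x <= 1.
Proof.
have m := measurable_sublevel t x.
rewrite /marginal fine_ge0 ?measure_ge0//=.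
by rewrite -lee_fin fineK ?fin_num_measure// probability_le1.
Qed.
End Brownian.

(** * Densities, and the theorem *)

Section Density.
Context {R : realType}.

Lemma taylor1_le (K K' : R) (phi psi : R -> R) : K <= K' ->
  taylor1 K phi psi -> taylor1 K' phi psi.
Proof.
move=> KK' [h1 h2]; split=> x y.
  by apply: (le_trans (h1 x y)); rewrite ler_wpM2r// sqr_ge0.
by apply: (le_trans (h2 x y)); rewrite ler_wpM2r.
Qed.

(** Together with the next lemma, this identifies a continuous density with the
    second component of [taylor1], by uniqueness of the derivative. *)
Lemma taylor1_is_derive (K x : R) (phi psi : R -> R) : 0 <= K ->
  taylor1 K phi psi -> is_derive x 1 phi (psi x).
Proof.
move=> K0 [h1 _].
suff cv : h^-1 *: (phi (h *: (1 : R) + x) - phi x) @[h --> 0^'] --> psi x.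
  by apply: DeriveDef; [apply/cvg_ex; exists (psi x)|exact: cvg_lim cv].
apply/cvgrPdist_lt => e e0; near=> h.
have hn0 : h != 0 by near: h; exact: nbhs_dnbhs_neq.
have he : `|h| < e / (K + 1).
  near: h; apply: (@cvg_within _ (nbhs 0)); apply/nbhs_ballP.
  exists (e / (K + 1)) => /=; first by rewrite divr_gt0// ltr_wpDl.
  by move=> z; rewrite /ball/= sub0r normrN.
rewrite ltr_pdivlMr ?ltr_wpDl// in he.
apply: le_lt_trans he; rewrite distrC.
have := h1 x (h *: 1 + x); set D := phi _ - phi x.
have -> : h *: 1 + x - x = h by rewrite addrK /GRing.scale/= mulr1.
have -> : h^-1 *: D - psi x = (D - psi x * h) / h by rewrite /GRing.scale/=; field.
move=> hD; rewrite normrM normfV ler_pdivrMr ?normr_gt0//.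
apply: (le_trans hD); rewrite -real_normK ?num_real// expr2 mulrA ler_wpM2r//.
by rewrite mulrC ler_wpM2l// lerDl.
Unshelve. all: by end_near. Qed.

Context {d : measure_display} {Omega : measurableType d}.
Variable P : probability Omega R.

Lemma density_is_derive (X : {RV P >-> R}) (g : R -> R) (x : R) :
  is_density X g -> continuous g ->
  is_derive x 1 (fun y => fine (P [set w | X w <= y])) (g x).
Proof.
move=> [g0 mg lawX] cg.
have ig : (@lebesgue_measure R).-integrable `]-oo, x + 1] (EFin \o g).
  apply/integrableP; split; first exact/measurable_EFinP/measurable_funTS.
  under eq_integral do rewrite /= ger0_norm//.
  by rewrite -lawX// (le_lt_trans (probability_le1 _ _)) ?ltry//; exact: measurable_funPTI.
have [||dF FE] := @continuous_FTC1 R g -oo%O x (x + 1) _ ig _ (cg x).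
- by rewrite ltrDl.
- by rewrite ltNyr.
have E : (fun y => fine (P [set w | X w <= y])) =
    (fun y => (\int[lebesgue_measure]_(t in [set` `]-oo, y]]) g t)%R).
  by apply/funext => y; rewrite /Rintegral -lawX.
rewrite E; apply: DeriveDef; first exact: dF.
by rewrite -derive1E; exact: FE.
Qed.
End Density.

Section Schwartz.
Context {R : realType}.

Lemma schwartz_derive (f : R -> R) (m : nat) (x : R) : schwartz f ->
  is_derive x 1 (f^`(m))%classic ((f^`(m.+1))%classic x).
Proof.
by move=> [sm _]; apply: DeriveDef; [exact: sm|rewrite derive1nS derive1E].
Qed.

Lemma schwartz_bounded (f : R -> R) (m : nat) : schwartz f ->
  exists M, forall x, `|(f^`(m))%classic x| <= M.
Proof.
move=> [_ /(_ 0%N m) [M ubM]]; exists M => x.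
have : (1 + `|x| ^+ 0) * `|(f^`(m))%classic x| <= M by apply: ubM; exists x.
rewrite expr0 => h; have := normr_ge0 ((f^`(m))%classic x); lra.
Qed.

(** The density is Lipschitz, hence at least half of its value at [x0] on a
    neighborhood of [x0], which every normal law charges. *)
Lemma blur_gt0 (K s x x0 : R) (phi f : R -> R) : 0 < K ->
  taylor1 K phi f -> (forall y, 0 <= f y) -> 0 < f x0 -> 0 < s -> 0 < blur s f x.
Proof.
move=> K0 h f0 fx0 s0; have [_ i2] := integrable_blur s x (ltW K0) h.
pose eta := f x0 / (2 * K); have eta0 : 0 < eta by rewrite divr_gt0// mulr_gt0.
apply: (@gmean_gt0 _ _ ((x - x0 - eta) / s) ((x - x0 + eta) / s) (f x0 / 2)).
- exact: i2.
- by move=> z; exact: f0.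
- by rewrite ltr_pM2r ?invr_gt0//; lra.
- by rewrite divr_gt0.
move=> z; rewrite ltr_pdivrMr// ltr_pdivlMr// => /andP[z1 z2].
have [_ lip] := h; have := lip x0 (x - s * z).
have : K * `|x - s * z - x0| <= f x0 / 2.
  have -> : f x0 / 2 = K * eta by rewrite /eta; field; rewrite gt_eqF.
  by rewrite ler_wpM2l ?(ltW K0)// ler_norml; lra.
by move=> h1 h2; have := le_trans h2 h1; rewrite ler_norml; lra.
Qed.
End Schwartz.

(** An expectation that is finite is that of an integrable variable, because the
    extended sum of opposite infinities is infinite. *)
Lemma expectation_mulB (R : realType) (d : measure_display)
    (Omega : measurableType d) (Q : probability Omega R)
    (X Y Z : {RV Q >-> R}) (a b : R) :
  ('E_Q[fun w => (X w * Y w)%R])%E = a%:E ->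
  ('E_Q[fun w => (X w * Z w)%R])%E = b%:E ->
  ('E_Q[fun w => (X w * (Z w - Y w))%R])%E = (b - a)%:E.
Proof.
rewrite unlock => ha hb.
have int (V : {RV Q >-> R}) c : (\int[Q]_w (X w * V w)%:E)%E = c%:E ->
    Q.-integrable setT (fun w => (X w * V w)%:E).
  move=> hc; have mXV : measurable_fun setT (fun w => X w * V w).
    by apply: measurable_funM.
  apply/integrableP; split; first exact/measurable_EFinP.
  by rewrite integral_fin_num_abs// hc.
have iY := int _ _ ha; have iZ := int _ _ hb.
under eq_integral do rewrite mulrBr EFinB.
by rewrite integralB//= hb ha.
Qed.

Theorem corollary3p4 (R : realType) (alpha : R)
  (halpha : 0 < alpha < 1)
  (d : measure_display) (Omega : measurableType d) (P : probability Omega R)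
  (B : R -> {RV P >-> R}) (hB : brownian_motion B)
  (f : R -> R) (hf : schwartz f) (hf0 : is_density (B 0) f)
  (q : R -> R)
  (hq0 : forall y : R,
    (\int[lebesgue_measure]_(x in `]-oo, y]) (f x)%:E)%E = alpha%:E <-> y = q 0)
  (hfq0 : 0 < f (q 0))
  (hq : forall t : R, 0 < t -> is_quantile (B t) alpha (q t))
  (u : R -> R -> R) (hu0 : forall x : R, u x 0 = f x)
  (hu : forall t : R, 0 < t ->
    is_density (B t) (fun x : R => u x t) /\ continuous (fun x : R => u x t))
  (d' : measure_display) (Omega' : measurableType d')
  (Q : probability Omega' R)
  (F : R -> {RV Q >-> R})
  (hF : centered_gaussian_process F) (hFc : continuous_paths F)
  (hFcov : forall s t : R, 0 <= s -> 0 <= t ->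
    'E_Q[fun w : Omega' => (F s w * F t w)%R]%E = (rho B alpha q u s t)%:E) :
  forall T : R, 0 < T ->
  exists delta C1 C2 : R, [/\ 0 < delta, 0 < C1, 0 < C2 &
    forall s t dt : R, 0 <= s -> s < t -> t <= T -> 0 < dt ->
      `|t - s| < delta -> dt < delta ->
      ((- C2 * `|t - s| `^ (- 2^-1) * dt)%:E
         <= 'E_Q[fun w : Omega' => (F s w * (F (t + dt) w - F t w))%R]%E)%E /\
      ('E_Q[fun w : Omega' => (F s w * (F (t + dt) w - F t w))%R]%E
         <= (- C1 * `|t + dt - s| `^ (- 2^-1) * dt)%:E)%E].

Proof.
case: hB => W [Wbm B0W BE].
have [g0 mg lawB0] := hf0.
have [M0 hM0] := schwartz_bounded 0 hf.
have [M1 hM1] := schwartz_bounded 1 hf.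
have [M2 hM2] := schwartz_bounded 2 hf.
pose K1 := Num.max 1 (Num.max M0 (Num.max M1 M2)).
have K1_gt0 : 0 < K1 by rewrite lt_max ltr01.
have M1K : M1 <= K1 by rewrite !le_max lexx !orbT.
have M2K : M2 <= K1 by rewrite !le_max lexx !orbT.
have M0K : M0 <= K1 by rewrite !le_max lexx !orbT.
pose f' := (f^`(1))%classic; pose G0 := marginal B 0.
have df (x : R) : is_derive x 1 f (f' x) by exact: (schwartz_derive 0 x hf).
have df' (x : R) : is_derive x 1 f' ((f^`(2))%classic x).
  exact: (schwartz_derive 1 x hf).
have hM2' (x : R) : `|(f^`(2))%classic x| <= K1 by exact: le_trans M2K.
have taylor_f : taylor1 K1 f f' by exact: (taylor1_of_derive df df' hM2').
have cf : continuous f by exact: (taylor1_continuous (ltW K1_gt0) taylor_f).1.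
have dG0 (x : R) : is_derive x 1 G0 (f x) by exact: density_is_derive.
have hM1' (x : R) : `|f' x| <= K1 by exact: le_trans M1K.
have taylor_G0 : taylor1 K1 G0 f by exact: (taylor1_of_derive dG0 df hM1').
pose v (t x : R) := blur (Num.sqrt t) f x.
(* a single constant for the bounds in space and those in time, the latter
   losing a factor [gmoment] *)
pose K := K1 * gmoment.
have K1K : K1 <= K by rewrite ler_peMr ?gmoment_ge1// ltW.
have K0 : 0 < K by exact: lt_le_trans K1K.
have GE (t : R) : 0 <= t -> marginal B t = blur (Num.sqrt t) G0.
  by move=> t0; apply/funext => x; exact: (marginal_blur Wbm B0W BE).
have G_taylor (t : R) : 0 <= t -> taylor1 K (marginal B t) (v t).
  move=> t0; rewrite GE//; apply: taylor1_le K1K _.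
  by apply: taylor1_blur => //; exact: ltW.
have G_homo (t x y : R) : 0 <= t -> x <= y -> marginal B t x <= marginal B t y.
  by move=> _; exact: marginal_homo.
have G_time (t t' x : R) : 0 <= t -> 0 <= t' ->
    `|marginal B t' x - marginal B t x| <= K * `|t' - t|.
  by move=> t0 t'0; rewrite !GE//; apply: (blur_sqrt_sub _ (ltW K1_gt0) taylor_G0).
have v_time (t t' x : R) : 0 <= t -> 0 <= t' -> `|v t' x - v t x| <= K * `|t' - t|.
  by move=> t0 t'0; apply: (blur_sqrt_sub _ (ltW K1_gt0) taylor_f).
have G_q (t : R) : 0 <= t -> marginal B t (q t) = alpha.
  rewrite le_eqVlt => /predU1P[<-|t0]; rewrite /marginal; last by rewrite (hq t t0).
  have := lawB0 `]-oo, q 0]%classic (measurable_itv _).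
  by rewrite ((hq0 (q 0)).2 erefl) => e; rewrite -[RHS]/(fine alpha%:E) -e.
have v_q_gt0 (t : R) : 0 <= t -> 0 < v t (q t).
  rewrite le_eqVlt => /predU1P[<-|t0].
    rewrite /v sqrtr0 /blur.
    have -> : (fun z : R => f (q 0 - 0 * z)) = (fun z => f (q 0) + 0 * z).
      by apply/funext => z; rewrite !mul0r subr0 addr0.
    by rewrite gmean_affine.
  by apply: (blur_gt0 _ K1_gt0 taylor_G0 g0 hfq0); rewrite sqrtr_gt0.
have G_01 (t x : R) : 0 <= t -> 0 <= marginal B t x <= 1 by move=> _; exact: marginal_01.
have v_le (t x : R) : 0 <= t -> v t x <= K.
  move=> t0; apply: le_trans (ler_norm _) _; apply: gmean_bound.
    exact: (integrable_blur _ _ (ltW K1_gt0) taylor_G0).2.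
  by move=> z; rewrite (le_trans _ K1K)// (le_trans (hM0 _)).
(* two derivatives of the same distribution function *)
have uE (t x : R) : 0 <= t -> u x t = v t x.
  rewrite le_eqVlt => /predU1P[<-|t0].
    rewrite hu0 /v sqrtr0 /blur -[LHS](gmean_affine _ 0); congr gmean.
    by apply/funext => z; rewrite !mul0r subr0 addr0.
  have [ud uc] := hu t t0.
  have d1 := density_is_derive x ud uc.
  have d2 := taylor1_is_derive x (ltW K0) (G_taylor t (ltW t0)).
  by rewrite -(@derive_val _ _ _ _ _ _ _ d1) -(@derive_val _ _ _ _ _ _ _ d2).
have rhoE (s t : R) : 0 <= s -> s < t ->
    rho B alpha q u s t = correlation alpha (marginal B) v q s t.
  move=> s0 st; have t0 : 0 <= t by exact: le_trans s0 (ltW st).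
  by rewrite /rho /correlation !uE// (marginal_joint Wbm B0W BE).
move=> T T0.
have [delta [C1 [C2 [delta0 C10 C20 est]]]] :=
  correlation_estimate K0 G_taylor G_homo G_time v_time G_q v_q_gt0 G_01 v_le halpha T0.
exists delta, C1, C2; split=> // s t dt s0 st tT dt0 tsd dtd.
have t0 : 0 <= t by exact: le_trans s0 (ltW st).
have tdt : s < t + dt by rewrite (lt_trans st)// ltrDl.
have tdt0 : 0 <= t + dt by exact: le_trans s0 (ltW tdt).
rewrite (expectation_mulB (hFcov s t s0 t0) (hFcov s (t + dt) s0 tdt0)).
rewrite !lee_fin !rhoE//.
by have /andP[] := est s t dt s0 st tT dt0 tsd dtd.
Qed.
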